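(* Let $N>1$ be an integer and let $\Gamma=\Gamma_0(N)$, $\Gamma_1(N)$ or $\Gamma(N)$. Then there is a constant $C_\Gamma>0$, depending only on $\Gamma$, such that for all real $x>1$ and $y$ with $x^{1/2}(\log x)^2<y<x$, $$\pi_\Gamma(x+y)-\pi_\Gamma(x)\le C_\Gamma\, y .$$
   Context: Congruence subgroups of $\mathrm{SL}_2(\mathbb{Z})$, for $\gamma=(\gamma_{ij})_{1\le i,j\le 2}$: $\Gamma_0(N)=\{\gamma:\gamma_{21}\equiv0\bmod N\}$; $\Gamma_1(N)=\{\gamma:\gamma_{11}\equiv\gamma_{22}\equiv\pm1,\ \gamma_{21}\equiv0\bmod N\}$; $\Gamma(N)=\{\gamma:\gamma_{11}\equiv\gamma_{22}\equiv\pm1,\ \gamma_{21}\equiv\gamma_{12}\equiv0\bmod N\}$. $\pi_\Gamma(x)$ is the number of primitive hyperbolic conjugacy classes $p$ of $\Gamma$ whose norm $N(p)$ is smaller than $x$, where $N(p)$ is the square of the larger eigenvalue of $p$. Hyperbolic elements are taken up to sign, i.e. represented by elements of trace $>2$; primitive means not a $k$-th power, $k\ge2$, of an element of $\Gamma$. *)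

(* Defs.v *)
From mathcomp Require Import all_boot all_order all_algebra.
From mathcomp Require Import finmap all_classical all_reals all_analysis.

Set Implicit Arguments.
Unset Strict Implicit.
Unset Printing Implicit Defensive.

Import Order.TTheory GRing.Theory Num.Theory.

Local Open Scope classical_set_scope.
Local Open Scope ring_scope.

(* Subgroups of SL_2(Z) are represented by their sets of matrices, and the     *)
(* entry gamma_{ij} (1 <= i, j <= 2) is [g (i - 1) (j - 1)].                   *)
Definition SL2Z : set 'M[int]_2 := [set g | \det g = 1].

Definition Gamma0 (N : nat) : set 'M[int]_2 :=
  [set g | SL2Z g /\ (g 1%R 0%R = 0 %[mod N])%Z].

Definition diag_pm1 (N : nat) (g : 'M[int]_2) : Prop :=
  (g 0%R 0%R = g 1%R 1%R %[mod N])%Z /\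
  ((g 1%R 1%R = 1 %[mod N])%Z \/ (g 1%R 1%R = - 1 %[mod N])%Z).

Definition Gamma1 (N : nat) : set 'M[int]_2 :=
  [set g | [/\ SL2Z g, diag_pm1 N g & (g 1%R 0%R = 0 %[mod N])%Z]].

Definition GammaN (N : nat) : set 'M[int]_2 :=
  [set g | [/\ SL2Z g, diag_pm1 N g,
               (g 1%R 0%R = 0 %[mod N])%Z & (g 0%R 1%R = 0 %[mod N])%Z]].

Definition conj_class (G : set 'M[int]_2) (g : 'M[int]_2) : set 'M[int]_2 :=
  [set h * g * h^-1 | h in G].

(* Hyperbolic means |tr g| > 2; as elements are taken up to sign, only the     *)
(* representative of positive trace is kept.                                   *)
Definition hyperbolic (g : 'M[int]_2) : Prop := 2 < \tr g.

Definition primitive_in (G : set 'M[int]_2) (g : 'M[int]_2) : Prop :=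
  forall (h : 'M[int]_2) (k : nat), G h -> (2 <= k)%N -> g <> h ^+ k.

(* A hyperbolic matrix has exactly two real eigenvalues, so that this supremum *)
(* is their maximum.                                                           *)
Definition larger_eigenvalue (R : realType) (g : 'M[int]_2) : R :=
  sup [set a : R | eigenvalue (map_mx intr g) a].

Definition hyp_norm (R : realType) (g : 'M[int]_2) : R :=
  larger_eigenvalue R g ^+ 2.

Definition prim_hyp_classes (R : realType) (G : set 'M[int]_2) (x : R) :
    set (set 'M[int]_2) :=
  [set conj_class G g | g in
    [set g | [/\ G g, hyperbolic g, primitive_in G g & hyp_norm R g < x]]].

(* [fset_set] sends infinite sets to [fset0]; for the congruence subgroups     *)
(* considered here [prim_hyp_classes G x] is finite for every x.               *)
Definition primeg_count (R : realType) (G : set 'M[int]_2) (x : R) : nat :=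
  #|` fset_set (prim_hyp_classes G x)|.

(* Main.v *)
Require Import Defs.
From mathcomp Require Import all_boot all_order all_algebra.
From mathcomp Require Import finmap all_classical all_reals all_analysis.
From mathcomp Require Import zify ring lra.

Set Implicit Arguments.
Unset Strict Implicit.
Unset Printing Implicit Defensive.

Import Order.TTheory GRing.Theory Num.Theory.

Local Open Scope classical_set_scope.
Local Open Scope ring_scope.

(** Why the bound holds.

    The group G contains every matrix of SL_2(Z) congruent to the identity
    modulo N.  A hyperbolic g of trace t is conjugate in SL_2(Z) to matrices
    r = u^-1 g u with positive entries, and [rotate] (conjugation by the first
    letter of r, read as a word in the two elementary unipotent matrices) walks
    among them.  On the Perron eigenvector v of r a step of the walk is one
    subtraction of the Euclidean algorithm, and it lowers log |v| by at most
    [weight] r = min (d / b, a / c).  The pairs (r, u mod N) are finite in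
    number, so the walk comes back to a pair already met; at that moment it has
    produced an element of G that commutes with g and dilates the common
    eigenvector.  If g is primitive in G, such an element dilates at least as
    much as g ([primitive_minimal]).  So every primitive class of trace t owns
    a set of pairs whose weights add up to at least log lam, where lam + 1 / lam
    = t ([class_weight]), and different classes own disjoint sets.  Hence the
    number of classes times log lam is at most the number of matrices modulo N
    times the total weight of the positive matrices of trace t.

    The weight is what makes the count sharp.  Runs of equal letters would make
    the plain number of positive matrices larger than wanted by a logarithm; on
    a run of length k the weights only add up to about log k.  Through the
    entries (c, a) or (b, d), the total weight is at most four times the sum of
    n / m over 1 <= n <= m with m (t - m) = 1 mod n ([sum_weight_le]).  Grouping
    by the quotient of m by n leaves the number of roots of X^2 - t X + 1 modulo
    the n <= N', which is at most N' H S, with H a harmonic sum and S the sum of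
    1 / g over g^2 | t^2 - 4 ([card_rootset_bound]): a second root is described
    by how it splits n against a first one, so the n-th term is a divisor
    function, up to repeated factors of t^2 - 4.  The logarithm H is cancelled
    by log lam, and the number of classes of trace t is O(t S).

    It remains to average S over the traces that occur.  They lie in an interval
    of length h = O(y / sqrt x) near sqrt x.  Since g^2 | (t - 2) (t + 2) forces
    g = e f or 2 e f with e^2 | t - 2 and f^2 | t + 2, the sum of S over h
    consecutive t is O(h + H^2) ([sum_sq_divisor_sum_le]), and H^2 = O((log x)^2)
    is O(y / sqrt x) by the hypothesis on y.  Multiplying by t = O(sqrt x) gives
    O(y). *)

(** * Roots of X^2 - tX + 1 modulo n *)

(** The congruence a^2 - t a + 1 = 0 mod n, with the negative term moved across
    so that no subtraction of naturals occurs. *)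
Definition qroot (t n a : nat) : bool := (a * t == a * a + 1 %[mod n])%N.

Lemma qrootE (t n a : nat) :
  qroot t n a = (n%:Z %| a%:Z * a%:Z - t%:Z * a%:Z + 1)%Z.
Proof.
rewrite /qroot eq_sym -eqz_nat -!modz_nat eqz_mod_dvd; congr (_ %| _)%Z; lia.
Qed.

Lemma qroot_modn (t n a : nat) : qroot t n (a %% n) = qroot t n a.
Proof. by rewrite /qroot modnMml -modnDml modnMm modnDml. Qed.

(** A reference root modulo n, to which the other roots are compared. *)
Definition base_root (t n : nat) : nat := find (qroot t n) (iota 0 n).

Lemma base_rootP (t n a : nat) : (a < n)%N -> qroot t n a ->
  qroot t n (base_root t n).
Proof.
move=> an ha.
have hh : has (qroot t n) (iota 0 n).
  by apply/hasP; exists a => //; rewrite mem_iota.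
have := nth_find 0%N hh; rewrite nth_iota ?add0n //.
by move: hh; rewrite has_find size_iota.
Qed.

Definition split_gcd (t n a : nat) : nat :=
  gcdn `|a%:Z - (base_root t n)%:Z|%N n.

(** If a and b are both roots then n divides (a - b) (a + b - t), so n = e f with
    e | a - b and f | a + b - t.  A common divisor g of e and f divides 2 b - t,
    and (2 b - t)^2 - (t^2 - 4) is a multiple of n, hence of g^2: repeated factors
    can only come from square divisors of t^2 - 4. *)
Lemma split_gcd_facts (t n a : nat) : (2 <= t)%N -> (a < n)%N -> qroot t n a ->
  let e := split_gcd t n a in let f := (n %/ e)%N in let g := gcdn e f in
  let b := (base_root t n)%:Z in
  [/\ (0 < e)%N, n = (e * f)%N, (e%:Z %| a%:Z - b)%Z, (f%:Z %| a%:Z + b - t%:Z)%Z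
    & (g ^ 2 %| t ^ 2 - 4)%N].
Proof.
move=> t2 an ha e f g b.
have n0 : (0 < n)%N by lia.
have e0 : (0 < e)%N by rewrite gcdn_gt0 n0 orbT.
have nE : n = (e * f)%N by rewrite mulnC divnK // dvdn_gcdr.
have hb : qroot t n (base_root t n) by apply: base_rootP ha.
have he : (e%:Z %| a%:Z - b)%Z by exact: dvdn_gcdl.
have hf : (f%:Z %| a%:Z + b - t%:Z)%Z.
  case/dvdzP: (he) => q hq.
  have cop : coprimez f%:Z q.
    rewrite /coprimez /gcdz /=.
    have : (e * gcdn f `|q|)%N = e.
      rewrite -[LHS]/(e * gcdn f `|q|)%N muln_gcdr -nE {2}/e /split_gcd gcdnC.
      by rewrite hq abszM mulnC.
    move=> /(congr1 (fun k => k %/ e)%N); rewrite mulKn // divnn e0 => ->.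
    by [].
  (* e q = a - b, and the difference of the two quadratic values factors *)
  have : (e%:Z * f%:Z %| e%:Z * (q * (a%:Z + b - t%:Z)))%Z.
    have -> : e%:Z * (q * (a%:Z + b - t%:Z)) = (a%:Z * a%:Z - t%:Z * a%:Z + 1) -
       (b * b - t%:Z * b + 1).
      have -> : e%:Z * (q * (a%:Z + b - t%:Z)) = (q * e%:Z) * (a%:Z + b - t%:Z) by ring.
      by rewrite -hq; ring.
    rewrite -(PoszM e f) -nE; apply: rpredB; rewrite -qrootE //.
  rewrite dvdz_mul2l; last by rewrite -[0]/(0%:Z) eqz_nat -lt0n.
  by rewrite Gauss_dvdzr.
split=> //.
have ge : (g%:Z %| e%:Z)%Z by exact: dvdn_gcdl.
have gf : (g%:Z %| f%:Z)%Z by exact: dvdn_gcdr.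
have gn : (g%:Z ^+ 2 %| n%:Z)%Z by rewrite nE PoszM expr2 dvdz_mul.
have h1 : (g%:Z %| 2 * b - t%:Z)%Z.
  have -> : 2 * b - t%:Z = (a%:Z + b - t%:Z) - (a%:Z - b) by ring.
  by apply: rpredB; [apply: dvdz_trans hf|apply: dvdz_trans he].
have E : t%:Z ^+ 2 - 4 = (t ^ 2 - 4)%N%:Z.
  by rewrite -subzn ?(@leq_exp2r 2 t 2) // -mulnn PoszM expr2.
have h2 : (g%:Z ^+ 2 %| (t ^ 2 - 4)%N%:Z)%Z.
  rewrite -E.
  have -> : t%:Z ^+ 2 - 4 = (2 * b - t%:Z) ^+ 2 - 4 * (b * b - t%:Z * b + 1) by ring.
  apply: rpredB; first by rewrite dvdz_exp2r.
  by apply: dvdz_mull; apply: dvdz_trans gn _; rewrite -qrootE.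
by move: h2; rewrite /dvdz abszX.
Qed.

Definition rootset (t N : nat) : {set 'I_N.+1 * 'I_N.+1} :=
  [set x : 'I_N.+1 * 'I_N.+1 | (x.2 < x.1)%N && qroot t x.1 x.2]%SET.

(** Codes for pairs (n, a): the splitting n = (g e) (g f) with g its gcd, and an
    index i < g that tells apart the roots with the same splitting. *)
Definition quadset (t N : nat) : {set 'I_N.+1 * 'I_N.+1 * 'I_N.+1 * 'I_N.+1} :=
  [set q : 'I_N.+1 * 'I_N.+1 * 'I_N.+1 * 'I_N.+1 |
    let: (g, e, f, i) := q in
    [&& (0 < g)%N, (g ^ 2 %| t ^ 2 - 4)%N, (0 < e)%N, (0 < f)%N,
        (f * (g ^ 2 * e) <= N)%N & (i < g)%N]]%SET.

(** The roots that split n as e f agree modulo lcm (e, f) = n / g; their quotients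
    by n / g are the indices that separate them. *)
Definition quad_code (t N : nat) (x : 'I_N.+1 * 'I_N.+1) :=
  let e := split_gcd t x.1 x.2 in let f := (x.1 %/ e)%N in let g := gcdn e f in
  (inord g, inord (e %/ g), inord (f %/ g), inord (x.2 %/ (x.1 %/ g)))
  : 'I_N.+1 * 'I_N.+1 * 'I_N.+1 * 'I_N.+1.

Lemma quad_code_facts (t N : nat) (x : 'I_N.+1 * 'I_N.+1) :
  (2 <= t)%N -> x \in rootset t N ->
  exists g e f i : nat,
   [/\ quad_code t x = (inord g, inord e, inord f, inord i),
     [&& g < N.+1, e < N.+1, f < N.+1 & i < N.+1]%N,
     [&& (0 < g)%N, (g ^ 2 %| t ^ 2 - 4)%N, (0 < e)%N, (0 < f)%N,
        (f * (g ^ 2 * e) <= N)%N & (i < g)%N],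
     x.1 = (g * e * (g * f))%N :> nat /\ i = (x.2 %/ (g * e * f))%N &
     (((g * e)%N%:Z %| x.2%:Z - (base_root t x.1)%:Z)%Z /\
      ((g * f)%N%:Z %| x.2%:Z + (base_root t x.1)%:Z - t%:Z)%Z) /\ coprime e f].
Proof.
move=> t2; rewrite inE => /andP[x21 xr].
have := split_gcd_facts t2 x21 xr; rewrite /quad_code.
set e := split_gcd _ _ _; set f := (_ %/ e)%N; set g := gcdn e f => /=.
case=> e0 nE he hf hg.
have x1N := ltn_ord x.1; have x2N := ltn_ord x.2.
have x10 : (0 < x.1)%N by apply: leq_ltn_trans x21.
have f0 : (0 < f)%N by move: x10; rewrite nE muln_gt0 => /andP[].
have g0 : (0 < g)%N by rewrite gcdn_gt0 e0.
have eE : e = (g * (e %/ g))%N by rewrite mulnC divnK // dvdn_gcdl.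
have fE : f = (g * (f %/ g))%N by rewrite mulnC divnK // dvdn_gcdr.
have cop : coprime (e %/ g) (f %/ g).
  rewrite /coprime -(eqn_pmul2l g0) muln_gcdr -eE -fE muln1; exact/eqP.
move: eE fE cop; set e' := (e %/ g)%N; set f' := (f %/ g)%N => eE fE cop.
have xgE : (x.1 %/ g = g * e' * f')%N.
  by rewrite nE eE fE -mulnA mulKn // mulnCA mulnA.
have e'0 : (0 < e')%N by move: e0; rewrite eE muln_gt0 => /andP[].
have f'0 : (0 < f')%N by move: f0; rewrite fE muln_gt0 => /andP[].
have nE' : x.1 = (g * e' * (g * f'))%N :> nat by rewrite -eE -fE.
exists g, e', f', (x.2 %/ (g * e' * f'))%N.
have iL : (x.2 %/ (g * e' * f') < g)%N.
  rewrite ltn_divLR ?muln_gt0 ?g0 ?e'0 //; apply: leq_trans x21 _.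
  by rewrite nE' mulnCA !mulnA.
have nleq : (f' * (g ^ 2 * e') <= N)%N.
  by rewrite -ltnS -mulnn mulnC -!mulnA [(g * (e' * f'))%N]mulnCA mulnA -nE'.
have le_div d : (d %| x.1)%N -> (d < N.+1)%N.
  by move=> /(dvdn_leq x10) dx; apply: leq_ltn_trans dx x1N.
have gx : (g %| x.1)%N by rewrite nE' -mulnA dvdn_mulr.
rewrite xgE; split=> //; last by rewrite -eE -fE.
- apply/and4P; split; first exact: le_div.
  + by apply: le_div; rewrite nE' dvdn_mulr // dvdn_mull.
  + by apply: le_div; rewrite nE' !dvdn_mull.
  + exact: ltn_trans iL (le_div _ gx).
- by apply/and5P; split=> //; apply/andP.
Qed.

Lemma card_rootset_le (t N : nat) : (2 <= t)%N ->
  (#|rootset t N| <= #|quadset t N|)%N.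
Proof.
move=> t2; rewrite -(card_in_imset (f := @quad_code t N)); last first.
  move=> [n a] [n' a'] hx hy hxy.
  have [g [e [f [i [cx]]]]] := quad_code_facts t2 hx.
  have [g' [e' [f' [i' [cy]]]]] := quad_code_facts t2 hy.
  case/and4P=> b1 b2 b3 b4 /and5P[b5 _ b6 b7 /andP[_ b8]] /= [nE' iE'] [[p1' p2'] _].
  case/and4P=> d1 d2 d3 d4 /and5P[d5 _ d6 d7 /andP[_ d8]] /= [nE iE] [[p1 p2] cop].
  move: hxy; rewrite cx cy => -[/(congr1 (@nat_of_ord _)) E1
    /(congr1 (@nat_of_ord _)) E2 /(congr1 (@nat_of_ord _)) E3
    /(congr1 (@nat_of_ord _)) E4].
  move: E1 E2 E3 E4; rewrite !inordK // => E1 E2 E3 E4; subst g' e' f'.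
  have nn : n = n' by apply: val_inj; rewrite /= nE nE'.
  subst n'; congr (_, _); apply: val_inj => /=.
  set m := (g * e * f)%N in iE iE' *.
  have mE : (m %| `|a%:Z - a'%:Z|)%N.
    have -> : m = lcmn (g * e) (g * f).
      by rewrite -muln_lcmr -[lcmn e f]muln1 -(eqP cop) muln_lcm_gcd mulnA.
    rewrite dvdn_lcm; apply/andP; split.
      suff : ((g * e)%N%:Z %| a%:Z - a'%:Z)%Z by [].
      have -> : a%:Z - a'%:Z = (a%:Z - (base_root t n)%:Z) - (a'%:Z - (base_root t n)%:Z) by ring.
      exact: rpredB.
    suff : ((g * f)%N%:Z %| a%:Z - a'%:Z)%Z by [].
    have -> : a%:Z - a'%:Z = (a%:Z + (base_root t n)%:Z - t%:Z)
       - (a'%:Z + (base_root t n)%:Z - t%:Z) by ring.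
    exact: rpredB.
  have : a = a' %[mod m].
    by apply/eqP; rewrite -eqz_nat -!modz_nat eqz_mod_dvd.
  move=> h; rewrite (divn_eq a m) (divn_eq a' m) h; congr (_ * _ + _)%N.
  by rewrite -iE -iE' E4.
apply: subset_leq_card; apply/fintype.subsetP => q /imsetP[x hx ->].
have [g [e [f [i [-> b h _ _]]]]] := quad_code_facts t2 hx.
by case/and4P: b => *; rewrite inE !inordK.
Qed.

(** * The number of roots modulo all n up to N *)

Lemma sum_ord_le_bound (n K : nat) : (\sum_(i < n) ((0 < i <= K) : nat) <= K)%N.
Proof.
suff: (\sum_(i < n) ((0 < i <= K) : nat) <= minn n.-1 K)%N by lia.
elim: n => [|n IH]; first by rewrite big_ord0.
rewrite big_ord_recr /=; move: IH; set s := bigop _ _ _; lia.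
Qed.

Lemma sum_ord_lt_bound (n K : nat) : (\sum_(i < n) ((i < K)%N : nat) <= K)%N.
Proof.
suff: (\sum_(i < n) ((i < K)%N : nat) <= minn n K)%N by lia.
elim: n => [|n IH]; first by rewrite big_ord0.
rewrite big_ord_recr /=; move: IH; set s := bigop _ _ _; lia.
Qed.

(** For fixed g and e there are at most N / (g^2 e) values of f, and g values of
    the index. *)
Lemma card_quadset_le (t N : nat) : (#|quadset t N| <=
  \sum_(g < N.+1 | (0 < g)%N && (g ^ 2 %| t ^ 2 - 4)%N)
   \sum_(e < N.+1 | (0 < e)%N) (N %/ (g ^ 2 * e)) * g)%N.
Proof.
pose F (g e f i : 'I_N.+1) : nat :=
  [&& (0 < g)%N, (g ^ 2 %| t ^ 2 - 4)%N, (0 < e)%N, (0 < f)%N,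
        (f * (g ^ 2 * e) <= N)%N & (i < g)%N].
have -> : #|quadset t N| = (\sum_g \sum_e \sum_f \sum_i F g e f i)%N.
  rewrite pair_bigA /= pair_bigA /= pair_bigA /= -sum1_card big_mkcond /=.
  by apply: eq_bigr => -[[[g e] f] i] _; rewrite inE /F /=; case: ifP.
rewrite [leqRHS]big_mkcond /=; apply: leq_sum => g _.
case: ifP => hg; last first.
  rewrite big1 // => e _; rewrite big1 // => f _; rewrite big1 // => i _.
  by rewrite /F andbA hg.
rewrite [leqRHS]big_mkcond /=; apply: leq_sum => e _.
case: ifP => he; last first.
  rewrite big1 // => f _; rewrite big1 // => i _.
  by rewrite /F he !andbF.
case/andP: hg => g0 hg.
apply: leq_trans (_ : (\sum_(f < N.+1) (0 < f <= N %/ (g ^ 2 * e)) * g <= _)%N).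
  apply: leq_sum => f _.
  apply: leq_trans (_ : (\sum_(i < N.+1) (0 < f <= N %/ (g ^ 2 * e)) * (i < g) <= _)%N).
    apply: leq_sum => i _; rewrite /F g0 hg he /= leq_divRL ?muln_gt0 ?expn_gt0 ?g0 //.
    by rewrite mulnb andbA.
  by rewrite -big_distrr /= leq_mul2l sum_ord_lt_bound orbT.
by rewrite -big_distrl /= leq_mul2r sum_ord_le_bound orbT.
Qed.

(** The term k = 0 vanishes, because the inverse of 0 is 0. *)
Definition harmonic_sum (R : realFieldType) (n : nat) : R := \sum_(k < n.+1) k%:R^-1.

(** Measures how much the repeated factors of t^2 - 4 can multiply the number of
    roots, on average over the modulus. *)
Definition sq_divisor_sum (R : realFieldType) (t N : nat) : R :=
  \sum_(g < N.+1 | (g ^ 2 %| t ^ 2 - 4)%N) g%:R^-1.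

Lemma natr_divn_le (R : realFieldType) (n q : nat) : (n %/ q)%:R <= n%:R / q%:R :> R.
Proof.
have [->|q0] := posnP q; first by rewrite divn0 invr0 mulr0.
by rewrite ler_pdivlMr ?ltr0n // -natrM ler_nat leq_trunc_div.
Qed.

(** Summing g N / (g^2 e) over e gives the harmonic sum, and over g the sum of
    1 / g over the square divisors g^2 of t^2 - 4. *)
Lemma card_rootset_bound (R : realFieldType) (t N : nat) : (2 <= t)%N ->
  #|rootset t N|%:R <= N%:R * (harmonic_sum R N * sq_divisor_sum R t N).
Proof.
move=> t2.
have := leq_trans (card_rootset_le N t2) (card_quadset_le t N).
rewrite -(ler_nat R) => /le_trans; apply.
have -> : N%:R * (harmonic_sum R N * sq_divisor_sum R t N) =
    \sum_(g < N.+1 | (g ^ 2 %| t ^ 2 - 4)%N) \sum_(e < N.+1) N%:R * (e%:R^-1 * g%:R^-1).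
  rewrite /sq_divisor_sum mulr_sumr mulr_sumr; apply: eq_bigr => g _.
  by rewrite /harmonic_sum mulr_suml mulr_sumr.
rewrite natr_sum big_mkcond [leRHS]big_mkcond /=; apply: ler_sum => g _.
have term_ge0 (e : 'I_N.+1) : 0 <= N%:R * (e%:R^-1 * g%:R^-1) :> R.
  by rewrite !mulr_ge0 ?invr_ge0.
case: (posnP g) => [_|g0] /=; first by case: ifP => // _; apply: sumr_ge0.
case: ifP => // _; rewrite natr_sum big_mkcond /=; apply: ler_sum => e _.
case: ifP => // e0; rewrite natrM.
apply: le_trans (_ : N%:R / (g ^ 2 * e)%:R * g%:R <= _).
  by rewrite ler_wpM2r // natr_divn_le.
have gn0 : g%:R != 0 :> R by rewrite pnatr_eq0 -lt0n.
have en0 : e%:R != 0 :> R by rewrite pnatr_eq0 -lt0n.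
rewrite natrM natrX le_eqVlt; apply/orP; left; apply/eqP.
by field; rewrite gn0.
Qed.

(** * The weighted sum over roots *)

Definition root_ratio_sum (R : realFieldType) (t : nat) : R :=
  \sum_(x : 'I_t.+1 * 'I_t.+1 | [&& (0 < x.1)%N, (x.1 <= x.2)%N & qroot t x.1 x.2])
     x.1%:R / x.2%:R.

(** The m with quotient j by n form a complete system of residues modulo n, so
    they contain each root class once; moreover n j <= m <= t. *)
Lemma card_root_window (t j : nat) : (0 < j)%N ->
  (#|[set x : 'I_t.+1 * 'I_t.+1 | [&& (0 < x.1)%N, (x.1 <= x.2)%N & qroot t x.1 x.2]
      && (x.2 %/ x.1 == j)%N]%SET| <= #|rootset t (t %/ j)|)%N.
Proof.
move=> j0; set A := [set x | _]%SET.
pose h (x : 'I_t.+1 * 'I_t.+1) : 'I_(t %/ j).+1 * 'I_(t %/ j).+1 :=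
  (inord x.1, inord (x.2 %% x.1)).
have hA x : x \in A -> [/\ (0 < x.1)%N, (x.1 < (t %/ j).+1)%N,
     (x.2 %% x.1 < x.1)%N, qroot t x.1 x.2 & (x.2 %/ x.1 == j)%N].
  rewrite inE => /andP[/and3P[x10 x12 xr] xj]; split => //; last by rewrite ltn_mod.
  rewrite ltnS leq_divRL // -(eqP xj) mulnC.
  by apply: leq_trans (leq_trunc_div _ _) _; rewrite -ltnS ltn_ord.
rewrite -(card_in_imset (f := h)); last first.
  move=> [n m] [n' m'] /hA /= [n0 n1 n2 _ /eqP n3] /hA /= [m0 m1 m2 _ /eqP m3].
  move=> [/(congr1 (@nat_of_ord _)) E1 /(congr1 (@nat_of_ord _)) E2].
  move: E1 E2; rewrite /= !inordK //; last 2 first.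
  - by apply: ltn_trans m2 m1.
  - by apply: ltn_trans n2 n1.
  move=> E1; have nn : n = n' by apply: val_inj.
  subst n' => E2; congr (_, _); apply: val_inj => /=.
  by rewrite (divn_eq m n) (divn_eq m' n) n3 m3 E2.
apply: subset_leq_card; apply/fintype.subsetP => q /imsetP[x /hA[x0 x1 x2 xr _] ->].
by rewrite inE /= !inordK ?x2 ?qroot_modn //; apply: ltn_trans x2 x1.
Qed.

Lemma root_ratio_sum_le_windows (R : realFieldType) (t : nat) :
  root_ratio_sum R t <= \sum_(j < t.+1) j%:R^-1 * #|rootset t (t %/ j)|%:R.
Proof.
apply: le_trans (_ : \sum_(x : 'I_t.+1 * 'I_t.+1 |
   [&& (0 < x.1)%N, (x.1 <= x.2)%N & qroot t x.1 x.2])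
     \sum_(j < t.+1) (x.2 %/ x.1 == j)%N%:R * j%:R^-1 <= _).
  apply: ler_sum => -[n m] /= /and3P[n0 nm _].
  have jt : (m %/ n < t.+1)%N by apply: leq_ltn_trans (leq_div _ _) (ltn_ord m).
  rewrite (bigD1 (Ordinal jt)) //= eqxx mul1r big1 ?addr0; last first.
    move=> j /eqP hj; case: eqP => [e|]; last by rewrite mul0r.
    by case: hj; apply: val_inj; rewrite /= -e.
  rewrite ler_pdivrMr ?ltr0n ?(leq_trans n0) //.
  rewrite mulrC ler_pdivlMr ?ltr0n ?divn_gt0 //.
  by rewrite -natrM ler_nat mulnC leq_trunc_div.
rewrite exchange_big /=; apply: ler_sum => j _.
rewrite -mulr_suml mulrC.
have [->|j0] := posnP j; first by rewrite invr0 !mul0r.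
rewrite ler_wpM2l ?invr_ge0 //; apply: le_trans (_ : #|_|%:R <= _); last first.
  by rewrite ler_nat; apply: card_root_window.
rewrite -sum1_card natr_sum [leRHS]big_mkcond [leLHS]big_mkcond /=.
apply: ler_sum => x _; rewrite inE; case: ifP => //= _; case: eqP => //.
Qed.

Lemma harmonic_sum_mono (R : realFieldType) (m n : nat) : 
  (m <= n)%N -> harmonic_sum R m <= harmonic_sum R n.
Proof.
move=> mn; rewrite /harmonic_sum (big_ord_widen n.+1 (fun k => k%:R^-1)) // big_mkcond /=.
by apply: ler_sum => k _; case: ifP => // _; rewrite invr_ge0.
Qed.

Lemma sq_divisor_sum_mono (R : realFieldType) (t m n : nat) :
  (m <= n)%N -> sq_divisor_sum R t m <= sq_divisor_sum R t n.
Proof.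
move=> mn; rewrite /sq_divisor_sum (big_ord_widen_cond n.+1
   (fun g => (g ^ 2 %| t ^ 2 - 4)%N) (fun k => k%:R^-1)) //.
rewrite big_mkcond [leRHS]big_mkcond /=.
by apply: ler_sum => k _; case: ifP => [/andP[->]|] // _; case: ifP; rewrite ?invr_ge0.
Qed.

Lemma harmonic_sum_ge0 (R : realFieldType) (n : nat) : 0 <= harmonic_sum R n.
Proof. by apply: sumr_ge0 => k _; rewrite invr_ge0. Qed.

Lemma sq_divisor_sum_ge0 (R : realFieldType) (t n : nat) : 0 <= sq_divisor_sum R t n.
Proof. by apply: sumr_ge0 => k _; rewrite invr_ge0. Qed.

Lemma sum_inv_sq_le2 (R : realFieldType) (n : nat) :
  \sum_(j < n) j%:R^-1 * j%:R^-1 <= 2 :> R.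
Proof.
have h m : \sum_(j < m.+2) j%:R^-1 * j%:R^-1 <= 2 - m.+1%:R^-1 :> R.
  elim: m => [|m IH]; first by rewrite 2!big_ord_recr big_ord0 /= invr0; lra.
  rewrite big_ord_recr /=; apply: le_trans (lerD IH (lexx _)) _.
  have m0 : 0 < m.+1%:R :> R by [].
  have e : m.+2%:R = m.+1%:R + 1 :> R by rewrite -natr1.
  rewrite e; set z := m.+1%:R in m0 *.
  rewrite -subr_ge0 (_ : _ - _ = (z * (z + 1) * (z + 1))^-1); last first.
    by field; apply/andP; split; lra.
  by rewrite invr_ge0 !mulr_ge0 //; lra.
case: n => [|[|m]]; first by rewrite big_ord0.
  by rewrite big_ord_recr big_ord0 /= invr0 mul0r add0r.
by apply: le_trans (h m) _; rewrite gerBl invr_ge0.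
Qed.

(** The window j contributes at most (1 / j) (t / j) H S, and the sum of 1 / j^2
    converges: large quotients cost nothing. *)
Lemma root_ratio_sum_le (R : realFieldType) (t : nat) : (2 <= t)%N ->
  root_ratio_sum R t <= 2 * t%:R * (harmonic_sum R t * sq_divisor_sum R t t).
Proof.
move=> t2; apply: le_trans (root_ratio_sum_le_windows R t) _.
have hs0 : 0 <= harmonic_sum R t * sq_divisor_sum R t t.
  by rewrite mulr_ge0 ?harmonic_sum_ge0 ?sq_divisor_sum_ge0.
apply: le_trans (_ : \sum_(j < t.+1) (j%:R^-1 * j%:R^-1) * 
   (t%:R * (harmonic_sum R t * sq_divisor_sum R t t)) <= _).
  apply: ler_sum => j _; rewrite -mulrA ler_wpM2l ?invr_ge0 //.
  apply: le_trans (card_rootset_bound R (t %/ j) t2) _.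
  rewrite [leRHS]mulrA [_ * t%:R]mulrC; apply: ler_pM => //.
  - by rewrite mulr_ge0 ?harmonic_sum_ge0 ?sq_divisor_sum_ge0.
  - exact: natr_divn_le.
  - by apply: ler_pM; rewrite ?harmonic_sum_ge0 ?sq_divisor_sum_ge0 //;
       rewrite ?harmonic_sum_mono ?sq_divisor_sum_mono // leq_div.
rewrite -mulr_suml -[leRHS]mulrA; apply: ler_wpM2r; last exact: sum_inv_sq_le2.
by rewrite mulr_ge0.
Qed.

(** * Averaging over the trace *)

(** Indeed gcd (a, k)^2 = gcd (a^2, a k, k^2) = gcd (a^2, a k, a b), which is a times
    gcd (a, k, b) = 1. *)
Lemma coprime_mul_sq (a b k : nat) : coprime a b -> (a * b = k ^ 2)%N ->
  a = (gcdn a k ^ 2)%N.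
Proof.
move=> cop abk.
rewrite -mulnn muln_gcdl !muln_gcdr [(k * a)%N]mulnC -gcdnA (gcdnA (a * k)) gcdnn.
rewrite (mulnn k) -abk -muln_gcdr -muln_gcdr [gcdn k b]gcdnC gcdnA (eqP cop).
by rewrite gcd1n muln1.
Qed.

(** A common divisor of u and u + 4 divides 4.  Splitting g^2 along u and u + 4,
    the two parts become coprime, hence squares, after division by 1, 2 or 4. *)
Lemma sq_dvd_mul_split (u g : nat) : (0 < u)%N -> (0 < g)%N ->
  (g ^ 2 %| u * (u + 4))%N ->
  exists e f : nat, [/\ (e ^ 2 %| u)%N, (f ^ 2 %| u + 4)%N &
     g = (e * f)%N \/ g = (2 * (e * f))%N].
Proof.
move=> u0 g0 guv.
set e0 := gcdn (g ^ 2) u; set f0 := (g ^ 2 %/ e0)%N.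
have e00 : (0 < e0)%N by rewrite gcdn_gt0 u0 orbT.
have gE : (e0 * f0 = g ^ 2)%N by rewrite mulnC divnK // dvdn_gcdl.
have e0u : (e0 %| u)%N by apply: dvdn_gcdr.
have f0v : (f0 %| u + 4)%N.
  have uE : u = (e0 * (u %/ e0))%N by rewrite mulnC divnK.
  have cop : coprime f0 (u %/ e0).
    rewrite /coprime -(eqn_pmul2l e00) muln_gcdr gE -uE muln1; exact/eqP.
  rewrite -(Gauss_dvdr _ cop) -(dvdn_pmul2l e00) gE mulnA -uE //.
set d := gcdn e0 f0.
have d0 : (0 < d)%N by rewrite gcdn_gt0 e00.
have d4 : (d %| 4)%N.
  have : (d %| (u + 4) - u)%N.
    by apply: dvdn_sub; [apply: dvdn_trans f0v; apply: dvdn_gcdr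
      |apply: dvdn_trans e0u; apply: dvdn_gcdl].
  by rewrite addKn.
have [e1 [f1 [eE fE cop]]] : exists e1 f1, [/\ e0 = (d * e1)%N, f0 = (d * f1)%N & coprime e1 f1].
  exists (e0 %/ d)%N, (f0 %/ d)%N.
  have eE : e0 = (d * (e0 %/ d))%N by rewrite mulnC divnK // dvdn_gcdl.
  have fE : f0 = (d * (f0 %/ d))%N by rewrite mulnC divnK // dvdn_gcdr.
  split=> //; by rewrite /coprime -(eqn_pmul2l d0) muln_gcdr -eE -fE muln1; exact/eqP.
have dg : (d %| g)%N.
  by rewrite -(@dvdn_pexp2r _ _ 2) // -gE eE fE -mulnn mulnACA dvdn_mulr.
have gdE : g = (d * (g %/ d))%N by rewrite mulnC divnK.
move: gdE; set k := (g %/ d)%N => gdE.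
have kE : (e1 * f1 = k ^ 2)%N.
  apply/eqP; rewrite -(@eqn_pmul2l (d * d)) ?muln_gt0 ?d0 //; apply/eqP.
  by rewrite mulnACA -eE -fE gE gdE expnMn mulnn.
have [e [f [e1E f1E]]] : exists e f, e1 = (e ^ 2)%N /\ f1 = (f ^ 2)%N.
  exists (gcdn e1 k), (gcdn f1 k); split; first exact: coprime_mul_sq kE.
  by apply: (@coprime_mul_sq _ e1); rewrite 1?coprime_sym // mulnC.
have k_ef : k = (e * f)%N.
  by apply/eqP; rewrite -(@eqn_exp2r _ _ 2) // -kE e1E f1E expnMn.
have d_cases : [\/ d = 1, d = 2 | d = 4]%N.
  have : (d \in divisors 4)%N by rewrite -dvdn_divisors.
  by rewrite !inE => /or3P[] /eqP ->; constructor.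
case: d_cases => dE.
- exists e, f; split; last by left; rewrite gdE dE k_ef mul1n.
  + by apply: dvdn_trans e0u; rewrite eE -e1E dvdn_mull.
  + by apply: dvdn_trans f0v; rewrite fE -f1E dvdn_mull.
- exists e, f; split; last by right; rewrite gdE dE k_ef.
  + by apply: dvdn_trans e0u; rewrite eE -e1E dvdn_mull.
  + by apply: dvdn_trans f0v; rewrite fE -f1E dvdn_mull.
- exists (2 * e)%N, (2 * f)%N; split; last by left; rewrite gdE dE k_ef; ring.
  + by apply: dvdn_trans e0u; rewrite eE dE expnMn -e1E.
  + by apply: dvdn_trans f0v; rewrite fE dE expnMn -f1E.
Qed.

Lemma count_multiples (q A h : nat) : (0 < q)%N ->
  (\sum_(k < h) ((q %| (A + k).+1)%N : nat) <= h %/ q + 1)%N.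
Proof.
move=> q0.
have E : (\sum_(k < h) ((q %| (A + k).+1)%N : nat) + A %/ q = (A + h) %/ q)%N.
  elim: h => [|h IH]; first by rewrite big_ord0 addn0.
  by rewrite big_ord_recr /= addnS divnS // -IH addnAC addnC.
rewrite -(leq_add2r (A %/ q)) E addnAC [(h %/ q + _)%N]addnC.
by rewrite divnD // leq_add2l leq_b1.
Qed.

Lemma sum_ord_pred1_le (R : realFieldType) (n k : nat) :
  \sum_(g < n) (g == k :> nat)%:R * g%:R^-1 <= k%:R^-1 :> R.
Proof.
have [kn|nk] := ltnP k n.
  rewrite (bigD1 (Ordinal kn)) //= eqxx mul1r big1 ?addr0 // => g /eqP hg.
  by case: eqP => [e|]; rewrite ?mul0r //; case: hg; apply: val_inj.
rewrite big1 ?invr_ge0 // => g _; case: eqP => [e|]; rewrite ?mul0r //.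
by have := ltn_ord g; rewrite e ltnNge nk.
Qed.

(** Each g of the left-hand side is e f or 2 e f for an admissible (e, f), whence
    the factor 1 + 1 / 2. *)
Lemma sq_divisor_sum_le_split (R : realFieldType) (t M : nat) : (3 <= t <= M)%N ->
  sq_divisor_sum R t t <= \sum_(e < M.+1) \sum_(f < M.+1)
    ((e ^ 2 %| t - 2) && (f ^ 2 %| t + 2))%N%:R * (3 / 2 * (e%:R^-1 * f%:R^-1)).
Proof.
move=> /andP[t3 tM]; apply: le_trans (sq_divisor_sum_mono R t tM) _.
pose c (e f : nat) : R := ((e ^ 2 %| t - 2) && (f ^ 2 %| t + 2))%N%:R.
have c0 e f : 0 <= c e f by rewrite /c.
pose w (g e f : nat) : R :=
  (g == (e * f)%N)%:R * g%:R^-1 + (g == (2 * (e * f))%N)%:R * g%:R^-1.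
apply: le_trans (_ : \sum_(g < M.+1) \sum_(e < M.+1) \sum_(f < M.+1)
   c e f * w g e f <= _).
  rewrite /sq_divisor_sum big_mkcond /=; apply: ler_sum => g _.
  have T0 (e f : nat) : 0 <= c e f * w g e f.
    by rewrite mulr_ge0 // /w addr_ge0 // mulr_ge0 // invr_ge0.
  have SS : 0 <= \sum_(e < M.+1) \sum_(f < M.+1) c e f * w g e f.
    by apply: sumr_ge0 => e _; apply: sumr_ge0.
  case: ifP => // hg; have [g00|g0] := posnP g.
    by apply: le_trans SS; rewrite g00 invr0.
  have u0 : (0 < t - 2)%N by rewrite subn_gt0.
  have uE : (t - 2 + 4 = t + 2)%N by lia.
  have [e [f [he hf gE]]] : exists e f : nat, [/\ (e ^ 2 %| t - 2)%N, (f ^ 2 %| t - 2 + 4)%N &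
     g = (e * f)%N :> nat \/ g = (2 * (e * f))%N :> nat].
    by apply: sq_dvd_mul_split => //; rewrite uE -subn_sqr.
  rewrite uE in hf.
  have ef0 : (0 < e * f)%N by case: gE g0 => ->; rewrite // (muln_gt0 2).
  have efM : (e * f < M.+1)%N.
    by apply: leq_ltn_trans (ltn_ord g); case: gE => ->; rewrite // leq_pmull.
  move: (ef0); rewrite muln_gt0 => /andP[e0 f0].
  have eM : (e < M.+1)%N by apply: leq_ltn_trans efM; rewrite leq_pmulr.
  have fM : (f < M.+1)%N by apply: leq_ltn_trans efM; rewrite leq_pmull.
  rewrite (bigD1 (Ordinal eM)) //= (bigD1 (Ordinal fM)) //= -addrA.
  apply: le_trans (_ : c e f * w g e f <= _).
    rewrite /c /w he hf mul1r -mulrDl ler_peMl ?invr_ge0 //.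
    by case: gE => /eqP ->; rewrite ?lerDl ?lerDr.
  rewrite lerDl addr_ge0 //.
    by apply: sumr_ge0.
  by apply: sumr_ge0 => i _; apply: sumr_ge0.
rewrite exchange_big /=; apply: ler_sum => e _.
rewrite exchange_big /=; apply: ler_sum => f _.
rewrite -mulr_sumr; apply: ler_wpM2l => //.
rewrite /w big_split /=; apply: le_trans (lerD (sum_ord_pred1_le _ _ _) (sum_ord_pred1_le _ _ _)) _.
rewrite !natrM !invfM; set x := (_ * f%:R^-1).
suff : 0 <= x by lra.
by rewrite mulr_ge0 ?invr_ge0.
Qed.

(** One of the two conditions is already enough: the larger of e^2 and f^2 is at
    least e f. *)
Lemma count_split_le (R : realFieldType) (T0 h e f : nat) : (3 <= T0)%N ->
  (0 < e)%N -> (0 < f)%N ->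
  \sum_(k < h) ((e ^ 2 %| T0 + k - 2) && (f ^ 2 %| T0 + k + 2))%N%:R <=
    h%:R * (e%:R^-1 * f%:R^-1) + 1 :> R.
Proof.
move=> T3 e0 f0.
suff [q [q0 efq hq]] : exists q, [/\ (0 < q)%N, (e * f <= q)%N &
   (\sum_(k < h) ((e ^ 2 %| T0 + k - 2) && (f ^ 2 %| T0 + k + 2)) <= h %/ q + 1)%N].
  rewrite -natr_sum; apply: le_trans (_ : (h %/ q + 1)%:R <= _); first by rewrite ler_nat.
  rewrite natrD lerD2r; apply: le_trans (natr_divn_le _ _ _) _.
  rewrite -invfM -natrM ler_wpM2l // lef_pV2 ?posrE ?ltr0n ?muln_gt0 ?e0 ?f0 //.
  by rewrite ler_nat.
have [ef|fe] := leqP e f.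
  exists (f ^ 2)%N; rewrite expn_gt0 f0 -mulnn leq_mul2r ef orbT; split=> //.
  apply: leq_trans (@count_multiples (f * f) (T0 + 1) h _); last by rewrite muln_gt0 f0.
  apply: leq_sum => k _; rewrite mulnn (_ : (T0 + 1 + k).+1 = T0 + k + 2)%N; last by lia.
  by case: (f ^ 2 %| _)%N; rewrite ?andbF ?leq_b1.
exists (e ^ 2)%N; rewrite expn_gt0 e0 -mulnn leq_mul2l (ltnW fe) orbT; split=> //.
apply: leq_trans (@count_multiples (e * e) (T0 - 3) h _); last by rewrite muln_gt0 e0.
apply: leq_sum => k _; rewrite mulnn (_ : (T0 - 3 + k).+1 = T0 + k - 2)%N; last by lia.
by case: (e ^ 2 %| _)%N; rewrite ?leq_b1.
Qed.

(** The main terms h / (e f)^2 sum to at most 4 h.  The error terms 1 / (e f), one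
    for each pair, sum to the square of a harmonic sum: this is the term that an
    interval of h >= (log x)^2 traces can absorb. *)
Lemma sum_sq_divisor_sum_le (R : realFieldType) (T0 h M : nat) :
  (3 <= T0)%N -> (T0 + h <= M.+1)%N ->
  \sum_(k < h) sq_divisor_sum R (T0 + k) (T0 + k) <= 6 * h%:R + 3 / 2 * harmonic_sum R M ^+ 2.
Proof.
move=> T3 hM.
apply: le_trans (_ : \sum_(k < h) \sum_(e < M.+1) \sum_(f < M.+1)
    ((e ^ 2 %| T0 + k - 2) && (f ^ 2 %| T0 + k + 2))%N%:R * (3 / 2 * (e%:R^-1 * f%:R^-1)) <= _).
  apply: ler_sum => k _; apply: sq_divisor_sum_le_split; have := ltn_ord k; lia.
rewrite exchange_big /=.
apply: le_trans (_ : \sum_(e < M.+1) \sum_(f < M.+1)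
   (h%:R * (3 / 2) * ((e%:R^-1 * e%:R^-1) * (f%:R^-1 * f%:R^-1))
     + 3 / 2 * (e%:R^-1 * f%:R^-1)) <= _).
  apply: ler_sum => e _; rewrite exchange_big /=; apply: ler_sum => f _.
  rewrite -mulr_suml.
  have [->|e0] := posnP e; first by rewrite invr0 !(mul0r, mulr0, addr0).
  have [->|f0] := posnP f; first by rewrite invr0 !(mul0r, mulr0, addr0).
  set x := e%:R^-1; set y := f%:R^-1.
  rewrite (_ : _ + _ = (h%:R * (x * y) + 1) * (3 / 2 * (x * y))); last by ring.
  rewrite ler_wpM2r ?count_split_le // !mulr_ge0 ?invr_ge0 //.
under eq_bigr do rewrite big_split -!mulr_sumr /=.
rewrite big_split /= -!mulr_sumr; apply: lerD.
  rewrite -mulr_suml; have := sum_inv_sq_le2 R M.+1; set s := bigop _ _ _ => s2.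
  have s0 : 0 <= s by apply: sumr_ge0 => j _; rewrite mulr_ge0 ?invr_ge0.
  rewrite -mulrA mulrCA [6 * _]mulrC mulrCA; apply: ler_wpM2l => //.
  have ss : s * s <= 2 * 2 by apply: ler_pM.
  lra.
by rewrite -mulr_suml expr2.
Qed.

(** * Two by two matrices and reduction to positive entries *)

Definition mx2 (T : Type) (a b c d : T) : 'M[T]_2 :=
  \matrix_(i, j) if i == 0 then if j == 0 then a else b
                 else if j == 0 then c else d.

Lemma ord2_cases (i : 'I_2) : i = 0 \/ i = 1.
Proof. by case: i => -[|[|//]] hi; [left|right]; apply: val_inj. Qed.

Lemma eq_mx2 (T : Type) (A B : 'M[T]_2) : A 0 0 = B 0 0 -> A 0 1 = B 0 1 ->
  A 1 0 = B 1 0 -> A 1 1 = B 1 1 -> A = B.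
Proof.
move=> h00 h01 h10 h11; apply/matrixP => i j.
by case: (ord2_cases i) => ->; case: (ord2_cases j) => ->.
Qed.

Lemma sum2 (V : nmodType) (F : 'I_2 -> V) : \sum_i F i = F 0 + F 1.
Proof.
rewrite big_ord_recl big_ord_recl big_ord0 addr0; congr (_ + F _).
exact: val_inj.
Qed.

Lemma mulmx2E (R : pzSemiRingType) (m n : nat) (A : 'M[R]_(m, 2)) (B : 'M[R]_(2, n))
  (i : 'I_m) (j : 'I_n) : (A *m B) i j = A i 0 * B 0 j + A i 1 * B 1 j.
Proof. by rewrite mxE sum2. Qed.

Lemma mulr2E (R : pzSemiRingType) (A B : 'M[R]_2) (i j : 'I_2) :
  (A * B) i j = A i 0 * B 0 j + A i 1 * B 1 j.
Proof. exact: mulmx2E. Qed.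

Lemma mxtrace2 (R : pzRingType) (A : 'M[R]_2) : \tr A = A 0 0 + A 1 1.
Proof. by rewrite /mxtrace sum2. Qed.

Lemma det2 (R : comNzRingType) (A : 'M[R]_2) :
  \det A = A 0 0 * A 1 1 - A 0 1 * A 1 0.
Proof.
rewrite (expand_det_row _ 0) sum2 /cofactor !det_mx11 !mxE /= !addn0 !expr0 !expr1.
rewrite mul1r mulN1r mulrN; congr (_ * A _ _ - _ * A _ _); exact: val_inj.
Qed.

Lemma det1_unit (g : 'M[int]_2) : \det g = 1 -> g \is a GRing.unit.
Proof.
move=> dg; have gu : g \in unitmx by rewrite unitmxE dg unitr1.
exact: gu.
Qed.

Lemma inv_mx2 (g : 'M[int]_2) : \det g = 1 ->
  g^-1 = mx2 (g 1 1) (- g 0 1) (- g 1 0) (g 0 0).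
Proof.
move=> dg; have gu := det1_unit dg.
apply: (mulrI gu); rewrite divrr //; move: dg; rewrite det2 => dg.
by apply: eq_mx2; rewrite mulr2E !mxE /=; try ring; rewrite -dg; ring.
Qed.

Lemma det1M (g h : 'M[int]_2) : \det g = 1 -> \det h = 1 -> \det (g * h) = 1.
Proof. by move=> dg dh; rewrite det_mulmx dg dh mulr1. Qed.

Lemma det1V (g : 'M[int]_2) : \det g = 1 -> \det g^-1 = 1.
Proof. by move=> dg; rewrite -[g^-1]/(invmx g) det_inv dg invr1. Qed.

Lemma mxtrace_conj (u g : 'M[int]_2) : \det u = 1 -> \tr (u^-1 * g * u) = \tr g.
Proof.
move=> du; rewrite -[_ * _ * _]/(u^-1 * g *m u) mxtrace_mulC.
by rewrite -[_ *m _]/(u * (u^-1 * g)) mulVKr // det1_unit.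
Qed.

Definition posmx (r : 'M[int]_2) : bool :=
  [&& 0 < r 0 0, 0 < r 0 1, 0 < r 1 0 & 0 < r 1 1].

Definition shear (j : int) : 'M[int]_2 := mx2 1 j 0 1.
Definition flip : 'M[int]_2 := mx2 0 (-1) 1 0.

Lemma det_shear j : \det (shear j) = 1.
Proof. by rewrite det2 !mxE /=; ring. Qed.
Lemma det_flip : \det flip = 1.
Proof. by rewrite det2 !mxE /=; ring. Qed.

Lemma conj_shearE (j : int) (g : 'M[int]_2) :
  (shear j)^-1 * g * shear j =
  mx2 (g 0 0 - j * g 1 0) (g 0 1 + j * (g 0 0 - g 1 1) - j * j * g 1 0)
      (g 1 0) (g 1 1 + j * g 1 0).
Proof.
rewrite inv_mx2 ?det_shear //.
by apply: eq_mx2; rewrite !mulr2E !mxE /=; ring.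
Qed.

Lemma conj_flipE (g : 'M[int]_2) :
  flip^-1 * g * flip = mx2 (g 1 1) (- g 1 0) (- g 0 1) (g 0 0).
Proof.
rewrite inv_mx2 ?det_flip //.
by apply: eq_mx2; rewrite !mulr2E !mxE /=; ring.
Qed.

(** Division by 2 c with the remainder centred at 0, for c of any sign. *)
Lemma shift_to_center (m c : int) : c != 0 -> exists j : int,
  `|m - 2 * (j * c)| <= `|c|.
Proof.
move=> c0; pose q := ((m + `|c|) %/ (2 * `|c|))%Z.
have e := divz_eq (m + `|c|) (2 * `|c|).
have lt := @ltz_pmod (m + `|c|) (2 * `|c|) ltac:(lia).
have ge := @modz_ge0 (m + `|c|) (2 * `|c|) ltac:(lia).
rewrite -/q in e; move: e lt ge; set r := modz _ _ => e lt ge.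
have [cp|cn] := ltrP 0 c.
  exists q; rewrite gtr0_norm // in e lt *; lia.
exists (- q); have cn' : c < 0 by lia.
rewrite ltr0_norm // in e lt *; lia.
Qed.

(** An integral triangular matrix of determinant 1 has trace 2 or -2. *)
Lemma hyperbolic_c_neq0 (g : 'M[int]_2) : \det g = 1 -> 2 < \tr g -> g 1 0 != 0.
Proof.
move=> dg tg; apply/eqP => c0; move: dg tg; rewrite det2 mxtrace2 c0 mulr0 subr0.
move: (g 0 0) (g 1 1) => a d h1 h2.
have a1 : 0 < a by nia.
have d1 : 0 < d by nia.
have : 0 <= (a - 1) * (d - 1) by apply: mulr_ge0; lia.
nia.
Qed.

(** Gauss reduction, by descent on |c|.  A translation makes |a - d| <= |c|.  If
    b c > 0 then a d > 1, so the matrix is positive up to [flip].  Otherwise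
    4 |b c| = (a - d)^2 + 4 - t^2 < c^2, so that [flip], which exchanges |b| and
    |c|, strictly decreases |c|. *)
Lemma hyperbolic_conj_pos (g : 'M[int]_2) : \det g = 1 -> 2 < \tr g ->
  exists u : 'M[int]_2, \det u = 1 /\ posmx (u^-1 * g * u).
Proof.
move: {2}(absz (g 1 0)) (leqnn (absz (g 1 0))) => n.
elim/ltn_ind: n g => n IH g gn dg tg.
have c0 := hyperbolic_c_neq0 dg tg.
have [j hj] := shift_to_center (g 0 0 - g 1 1) c0.
pose g' := (shear j)^-1 * g * shear j.
have dg' : \det g' = 1 by rewrite !det1M ?det1V ?det_shear.
have tg' : \tr g' = \tr g by rewrite mxtrace_conj ?det_shear.
have c' : g' 1 0 = g 1 0 by rewrite /g' conj_shearE mxE.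
have hm : `|g' 0 0 - g' 1 1| <= `|g' 1 0|.
  apply: le_trans (_ : `|g 1 0| <= _); last by rewrite c'.
  by move: hj; rewrite /g' conj_shearE !mxE /=; congr (`|_| <= _); ring.
have compose u : \det u = 1 -> posmx (u^-1 * g' * u) ->
   exists u0 : 'M[int]_2, \det u0 = 1 /\ posmx (u0^-1 * g * u0).
  move=> du pu; exists (shear j * u); split; first by rewrite det1M ?det_shear.
  by rewrite invrM ?det1_unit ?det_shear // !mulrA -!mulrA in pu *; rewrite !mulrA in pu *.
clearbody g'.
have d1 : g' 0 0 * g' 1 1 = 1 + g' 0 1 * g' 1 0 by rewrite -dg' det2; ring.
have t1 : 2 < g' 0 0 + g' 1 1 by rewrite -mxtrace2 tg'.
have c0' : g' 1 0 != 0 by rewrite c'.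
have [bc|bc] := ltrP 0 (g' 0 1 * g' 1 0).
  have ad : 0 < g' 0 0 * g' 1 1 by lia.
  have [a0 e0] : 0 < g' 0 0 /\ 0 < g' 1 1 by split; nia.
  have [cp|cn] := ltrP 0 (g' 1 0).
    apply: (compose 1); first by rewrite det1.
    by rewrite (pmulr_lgt0 _ cp) in bc; rewrite invr1 mul1r mulr1 /posmx a0 cp e0 bc.
  have cn' : g' 1 0 < 0 by lia.
  apply: (compose flip); first exact: det_flip.
  rewrite conj_flipE /posmx !mxE /= a0 e0 !oppr_gt0 cn' /= andbT.
  by rewrite (nmulr_lgt0 _ cn') in bc.
have bsmall : (absz (g' 0 1)%R < absz (g 1 0)%R)%N.
  suff : 4 * (`|g' 0 1| * `|g' 1 0|) < `|g' 1 0| * `|g' 1 0|.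
    rewrite -c'; move=> h; have : 0 < `|g' 1 0| by rewrite normr_gt0.
    move: h; rewrite -!abszE; move: (absz (g' 0 1)) (absz (g' 1 0)) => p q; nia.
  rewrite -!normrM (ler0_norm bc).
  have : (g' 0 0 - g' 1 1) ^+ 2 <= `|g' 1 0| ^+ 2.
    by rewrite -[X in X <= _]real_normK ?num_real // ler_sqr ?nnegrE.
  rewrite normrM; nia.
have := IH (absz (g' 0 1)) (leq_trans bsmall gn) (flip^-1 * g' * flip).
rewrite conj_flipE mxE /= abszN leqnn => /(_ isT).
rewrite -conj_flipE => -[||u [du pu]].
- by rewrite !det1M ?det1V ?det_flip.
- by rewrite mxtrace_conj ?det_flip // tg'.
apply: (compose (flip * u)); first by rewrite det1M ?det_flip.
by rewrite invrM ?det1_unit ?det_flip // !mulrA; rewrite !mulrA in pu.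
Qed.

(** * Rotating a positive matrix *)

Definition lower : 'M[int]_2 := mx2 1 0 1 1.

Lemma det_lower : \det lower = 1.
Proof. by rewrite det2 !mxE /=; ring. Qed.

Lemma inv_shear1 : (shear 1)^-1 = mx2 1 (-1) 0 1.
Proof. by rewrite inv_mx2 ?det_shear // !mxE. Qed.

Lemma inv_lower : lower^-1 = mx2 1 0 (-1) 1.
Proof. by rewrite inv_mx2 ?det_lower // !mxE. Qed.

Definition letter (r : 'M[int]_2) : 'M[int]_2 :=
  if r 1 1 <= r 0 1 then shear 1 else lower.

Definition rotate (r : 'M[int]_2) : 'M[int]_2 := (letter r)^-1 * r * letter r.

Lemma det_letter (r : 'M[int]_2) : \det (letter r) = 1.
Proof. by rewrite /letter; case: ifP => _; rewrite ?det_shear ?det_lower. Qed.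

Lemma det_rotate (r : 'M[int]_2) : \det r = 1 -> \det (rotate r) = 1.
Proof. by move=> dr; rewrite !det1M ?det1V ?det_letter. Qed.

(** Otherwise the determinant would be at least 3, or at most 0.  The dominating
    row tells the first letter of the word in [shear 1] and [lower] that spells r. *)
Lemma row_dominance (r : 'M[int]_2) : \det r = 1 -> posmx r ->
  (r 1 1 <= r 0 1 /\ r 1 0 < r 0 0) \/
  (r 0 1 < r 1 1 /\ r 0 0 <= r 1 0).
Proof.
rewrite det2 => dr /and4P[]; move: (r 0 0) (r 0 1) (r 1 0) (r 1 1) dr => a b c d dr a0 b0 c0 d0.
have [db|bd] := lerP d b; [left|right]; split=> //.
  rewrite ltNge; apply/negP => ac.
  have : a * d <= c * b by apply: ler_pM; lia.
  lia.
rewrite leNgt; apply/negP => ca.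
have : (c + 1) * (b + 1) <= a * d by apply: ler_pM; lia.
lia.
Qed.

Lemma rotateE (r : 'M[int]_2) : rotate r =
  if r 1 1 <= r 0 1 then mx2 (r 0 0 - r 1 0) (r 0 0 - r 1 0 + (r 0 1 - r 1 1))
                             (r 1 0) (r 1 0 + r 1 1)
  else mx2 (r 0 0 + r 0 1) (r 0 1) (r 1 0 - r 0 0 + (r 1 1 - r 0 1)) (r 1 1 - r 0 1).
Proof.
rewrite /rotate /letter; case: ifP => _; rewrite ?inv_shear1 ?inv_lower;
  by apply: eq_mx2; rewrite !mulr2E !mxE /=; ring.
Qed.

Lemma posmx_rotate (r : 'M[int]_2) : \det r = 1 -> posmx r -> posmx (rotate r).
Proof.
move=> dr pr; have dR := det_rotate dr; move: dR.
have := row_dominance dr pr; case/and4P: pr => a0 b0 c0 d0.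
rewrite rotateE det2 /posmx; case=> [[h1 h2]|[h1 h2]].
  rewrite h1 !mxE /= c0 => _; rewrite subr_gt0 h2 /=; lia.
rewrite leNgt h1 !mxE /= b0 => _; lia.
Qed.

Definition realmx (R : realType) (g : 'M[int]_2) : 'M[R]_2 := map_mx intr g.

Lemma realmxM (R : realType) (g h : 'M[int]_2) (v : 'cV[R]_2) :
  realmx R (g * h) *m v = realmx R g *m (realmx R h *m v).
Proof. by rewrite /realmx -[g * h]/(g *m h) map_mxM mulmxA. Qed.

Lemma realmx1 (R : realType) (v : 'cV[R]_2) : realmx R 1 *m v = v.
Proof. by rewrite /realmx map_mx1 mul1mx. Qed.

Lemma realmxK (R : realType) (u : 'M[int]_2) (v : 'cV[R]_2) : \det u = 1 ->
  realmx R u^-1 *m (realmx R u *m v) = v.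
Proof. by move=> du; rewrite -realmxM mulVr ?det1_unit // realmx1. Qed.

Lemma realmxVK (R : realType) (u : 'M[int]_2) (v : 'cV[R]_2) : \det u = 1 ->
  realmx R u *m (realmx R u^-1 *m v) = v.
Proof. by move=> du; rewrite -realmxM divrr ?det1_unit // realmx1. Qed.

Lemma cv2P (R : realType) (v w : 'cV[R]_2) : v 0 0 = w 0 0 -> v 1 0 = w 1 0 -> v = w.
Proof.
move=> h0 h1; apply/matrixP => i j; rewrite ord1.
by case: (ord2_cases i) => ->.
Qed.

(** If v is the Perron eigenvector, this is an upper bound in terms of the entries
    for the ratio of the smaller coordinate of v to the larger one. *)
Definition weight (R : realType) (r : 'M[int]_2) : R :=
  Num.min ((r 1 1)%:~R / (r 0 1)%:~R) ((r 0 0)%:~R / (r 1 0)%:~R).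

Definition height (R : realType) (v : 'cV[R]_2) : R := v 0 0 + v 1 0.

Definition poscv (R : realType) (v : 'cV[R]_2) : bool := (0 < v 0 0) && (0 < v 1 0).

Lemma eigen_eqs (R : realType) (g : 'M[int]_2) (v : 'cV[R]_2) (lam : R) :
  realmx R g *m v = lam *: v ->
  (g 0 0)%:~R * v 0 0 + (g 0 1)%:~R * v 1 0 = lam * v 0 0 /\
  (g 1 0)%:~R * v 0 0 + (g 1 1)%:~R * v 1 0 = lam * v 1 0.
Proof.
move=> e; split.
  by have := congr1 (fun w : 'cV[R]_2 => w 0 0) e; rewrite mulmx2E !mxE.
by have := congr1 (fun w : 'cV[R]_2 => w 1 0) e; rewrite mulmx2E !mxE.
Qed.

(** With v = (x, y), the row that dominates tells whether x > y, and the new vector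
    is (x - y, y) or (x, y - x).  Say x > y: then [height] drops from x + y to x,
    and y / x = (lam - a) / b < d / b because lam < a + d. *)
Lemma rotate_vec (R : realType) (r : 'M[int]_2) (v : 'cV[R]_2) (lam : R) :
  \det r = 1 -> posmx r -> poscv v -> realmx R r *m v = lam *: v ->
  0 < lam -> lam < (\tr r)%:~R ->
  let v' := realmx R (letter r)^-1 *m v in
  [/\ poscv v', height v' < height v & height v - height v' <= weight R r * height v'].
Proof.
move=> dr pr /andP[x0 y0] /eigen_eqs[e0 e1] lam0 lamt /=.
have rd := row_dominance dr pr; move: pr lamt e0 e1 rd; rewrite mxtrace2 rmorphD /=.
have wE i : (realmx R (letter r)^-1 *m v) i 0 =
    ((letter r)^-1 i 0)%:~R * v 0 0 + ((letter r)^-1 i 1)%:~R * v 1 0.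
  by rewrite mulmx2E !mxE.
rewrite /posmx /poscv /height /weight !wE /letter.
move: (v 0 0) (v 1 0) x0 y0 => x y x0 y0.
move: (r 0 0) (r 0 1) (r 1 0) (r 1 1) => a b c d /and4P[a0 b0 c0 d0] lamt e0 e1.
have [A0 [B0 [C0 D0]]] : (0 < a%:~R :> R /\ 0 < b%:~R :> R /\ 0 < c%:~R :> R /\ 0 < d%:~R :> R)%R.
  by rewrite !ltr0z.
case=> [[h1 h2]|[h1 h2]].
  rewrite h1 inv_shear1 !mxE /= !rmorphN !rmorph1 !rmorph0 /=.
  have H1 : d%:~R <= b%:~R :> R by rewrite ler_int.
  have H2 : c%:~R < a%:~R :> R by rewrite ltr_int.
  move: (a%:~R) (b%:~R) (c%:~R) (d%:~R) A0 B0 C0 D0 lamt e0 e1 H1 H2 =>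
    A B C D A0 B0 C0 D0 lamt e0 e1 H1 H2.
  have yx : y < x.
    rewrite -(ltr_pM2l lam0) -e0 -e1; apply: ltr_leD.
      by rewrite ltr_pM2r.
    by rewrite ler_pM2r.
  split; [by apply/andP; split; lra|lra|].
  rewrite (_ : _ - _ = y); last by ring.
  rewrite (_ : 1 * x + _ + _ = x); last by ring.
  rewrite minr_pMl ?(ltW x0) // le_min; apply/andP; split.
    rewrite mulrAC ler_pdivlMr //; nra.
  rewrite mulrAC ler_pdivlMr //; nra.
rewrite leNgt h1 /= inv_lower !mxE /= !rmorphN !rmorph1 !rmorph0 /=.
have H1 : b%:~R < d%:~R :> R by rewrite ltr_int.
have H2 : a%:~R <= c%:~R :> R by rewrite ler_int.
move: (a%:~R) (b%:~R) (c%:~R) (d%:~R) A0 B0 C0 D0 lamt e0 e1 H1 H2 =>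
    A B C D A0 B0 C0 D0 lamt e0 e1 H1 H2.
have xy : x < y.
  rewrite -(ltr_pM2l lam0) -e0 -e1; apply: ler_ltD.
    by rewrite ler_pM2r.
  by rewrite ltr_pM2r.
split; [by apply/andP; split; lra|lra|].
rewrite (_ : _ - _ = x); last by ring.
rewrite (_ : 1 * x + _ + _ = y); last by ring.
rewrite minr_pMl ?(ltW y0) // le_min; apply/andP; split.
  rewrite mulrAC ler_pdivlMr //; nra.
rewrite mulrAC ler_pdivlMr //; nra.
Qed.

(** * Primitive elements dilate least *)

(** The centralizer of a hyperbolic g is spanned over the rationals by 1 and g, so
    its elements are diagonalizable, and one with the double eigenvalue 1 is the
    identity.  In entries, commutation and trace 2 give r^2 (t^2 - 4) = 0 for the
    lower left entry r of h. *)
Lemma parabolic_commuting_eq1 (g h : 'M[int]_2) : \det g = 1 -> 2 < \tr g ->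
  \det h = 1 -> h * g = g * h -> \tr h = 2 -> h = 1.
Proof.
move=> dg tg dh hg th.
have c0 := hyperbolic_c_neq0 dg tg.
have e00 := congr1 (fun A : 'M[int]_2 => A 0 0) hg.
have e10 := congr1 (fun A : 'M[int]_2 => A 1 0) hg.
move: e00 e10 dg tg dh th c0; rewrite /= !mulr2E !det2 !mxtrace2.
move=> e00 e10 dg tg dh th c0.
suff [h1 h2 h3 h4] : [/\ h 0 0 = 1, h 0 1 = 0, h 1 0 = 0 & h 1 1 = 1].
  by apply: eq_mx2; rewrite ?h1 ?h2 ?h3 ?h4 !mxE.
move: e00 e10 dg tg dh th c0.
move: (g 0 0) (g 0 1) (g 1 0) (g 1 1) (h 0 0) (h 0 1) (h 1 0) (h 1 1) => a b c d p q r s.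
move=> e00 e10 dg tg dh th c0.
have cq : q * c = b * r by lia.
have cr : r * (a - d) = 2 * c * (p - 1).
  have sE : s = 2 - p by lia.
  by move: e10; rewrite sE; lia.
have qr : q * r = - (p - 1) ^+ 2.
  have -> : q * r = p * s - 1 by lia.
  have -> : s = 2 - p by lia.
  ring.
have rdisc0 : r ^+ 2 * ((a + d) ^+ 2 - 4) = 0.
  have -> : (a + d) ^+ 2 - 4 = (a - d) ^+ 2 + 4 * (b * c).
    have : (a + d) ^+ 2 - 4 * (a * d - b * c) = (a - d) ^+ 2 + 4 * (b * c) by ring.
    by rewrite dg mulr1.
  have -> : r ^+ 2 * ((a - d) ^+ 2 + 4 * (b * c)) =
     (r * (a - d)) ^+ 2 + 4 * c * r * (b * r) by ring.
  rewrite cr -cq.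
  have -> : (2 * c * (p - 1)) ^+ 2 + 4 * c * r * (q * c) =
     4 * c ^+ 2 * ((p - 1) ^+ 2 + q * r) by ring.
  by rewrite qr subrr mulr0.
have r0 : r = 0.
  apply/eqP; move/eqP: rdisc0; rewrite mulf_eq0 expf_eq0 /= => /orP[//|/eqP]; nia.
have p1 : p = 1.
  move: cr; rewrite r0 mul0r => /esym/eqP; rewrite !mulf_eq0 (negPf c0) /=; lia.
have q0 : q = 0.
  by move: cq; rewrite r0 mulr0 => /eqP; rewrite mulf_eq0 (negPf c0) orbF => /eqP.
by split=> //; lia.
Qed.

Lemma eigen_trace (R : realType) (h : 'M[int]_2) (v : 'cV[R]_2) (sig : R) :
  \det h = 1 -> v != 0 -> realmx R h *m v = sig *: v ->
  sig ^+ 2 - (\tr h)%:~R * sig + 1 = 0.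
Proof.
move=> dh v0 /eigen_eqs[e0 e1].
have dR : (h 0 0)%:~R * (h 1 1)%:~R - (h 0 1)%:~R * (h 1 0)%:~R = 1 :> R.
  by rewrite -!intrM -rmorphB /= -det2 dh.
rewrite mxtrace2 rmorphD /=.
move: e0 e1 dR.
move: ((h 0 0)%:~R : R) ((h 0 1)%:~R : R) ((h 1 0)%:~R : R) ((h 1 1)%:~R : R) => a b c d e0 e1 dR.
have k0 : (sig ^+ 2 - (a + d) * sig + 1) * v 0 0 = 0.
  rewrite -dR; have -> : (sig ^+ 2 - (a + d) * sig + (a * d - b * c)) * v 0 0 =
    (sig - d) * (sig * v 0 0 - a * v 0 0) - b * (c * v 0 0) by ring.
  rewrite -e0 (_ : c * v 0 0 = sig * v 1 0 - d * v 1 0); last by rewrite -e1; ring.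
  ring.
have k1 : (sig ^+ 2 - (a + d) * sig + 1) * v 1 0 = 0.
  rewrite -dR; have -> : (sig ^+ 2 - (a + d) * sig + (a * d - b * c)) * v 1 0 =
    (sig - a) * (sig * v 1 0 - d * v 1 0) - c * (b * v 1 0) by ring.
  rewrite -e1 (_ : b * v 1 0 = sig * v 0 0 - a * v 0 0); last by rewrite -e0; ring.
  ring.
apply/eqP; apply: contraNT v0 => s0; apply/eqP; apply: cv2P; rewrite mxE; apply/eqP.
  by move/eqP: k0; rewrite mulf_eq0 (negPf s0).
by move/eqP: k1; rewrite mulf_eq0 (negPf s0).
Qed.

Lemma realmx_exp (R : realType) (h : 'M[int]_2) (v : 'cV[R]_2) (sig : R) (k : nat) :
  realmx R h *m v = sig *: v -> realmx R (h ^+ k) *m v = sig ^+ k *: v.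
Proof.
move=> e; elim: k => [|k IH]; first by rewrite !expr0 realmx1 scale1r.
by rewrite exprSr realmxM e -scalemxAr IH scalerA -exprS.
Qed.

Lemma realmx_inv (R : realType) (h : 'M[int]_2) (v : 'cV[R]_2) (sig : R) :
  \det h = 1 -> sig != 0 ->
  realmx R h *m v = sig *: v -> realmx R h^-1 *m v = sig^-1 *: v.
Proof.
move=> dh s0 e; rewrite -[X in realmx R h^-1 *m X](scalerK s0) -e.
by rewrite -scalemxAr realmxK.
Qed.

Lemma exp_between (R : realType) (sig lam : R) : 1 < sig -> 1 <= lam ->
  exists k : nat, sig ^+ k <= lam < sig ^+ k.+1.
Proof.
move=> s1 l1.
have bern k : 1 + k%:R * (sig - 1) <= sig ^+ k.
  elim: k => [|k IH]; first by rewrite mul0r addr0 expr0.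
  have ss : 0 <= (k%:R * (sig - 1)) * (sig - 1) by rewrite !mulr_ge0 // subr_ge0 ltW.
  rewrite exprSr; apply: le_trans (_ : (1 + k%:R * (sig - 1)) * sig <= _); last first.
    by rewrite ler_pM2r //; lra.
  rewrite -natr1; lra.
have ex : exists k, lam < sig ^+ k.+1.
  exists (Num.trunc ((lam - 1) / (sig - 1))).
  apply: lt_le_trans (bern _).
  have := truncnS_gt ((lam - 1) / (sig - 1)); rewrite ltr_pdivrMr ?subr_gt0 //; lra.
exists (ex_minn ex); case: ex_minnP => k hk mink; rewrite hk andbT.
case: k hk mink => [|k] hk mink; first by rewrite expr0.
by rewrite leNgt; apply/negP => /mink; rewrite ltnn.
Qed.

(** All that is used about the groups: subgroups of SL_2(Z) containing the principal
    congruence subgroup of level N. *)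
Definition cong_group (N : nat) (G : set 'M[int]_2) : Prop :=
  [/\ forall g, G g -> \det g = 1,
      forall g h, G g -> G h -> G (g * h),
      forall g, G g -> G g^-1 &
      forall g, \det g = 1 -> map_mx intr g = 1 :> 'M['Z_N]_2 -> G g].

(** Euclidean descent inside the centralizer of g.  If sig < lam, divide lam by a
    power sig^k: the quotient sig' lies in [1, sig) and belongs to g h^-k.  If
    sig' > 1, this element has a smaller trace sig' + 1 / sig', which is a positive
    integer, so the descent stops.  If sig' = 1, then g = h^k, against
    primitivity. *)
Lemma primitive_minimal (R : realType) (N : nat) (G : set 'M[int]_2)
  (g : 'M[int]_2) (v : 'cV[R]_2) (lam : R) :
  cong_group N G -> G g -> 2 < \tr g -> primitive_in G g ->
  v != 0 -> realmx R g *m v = lam *: v -> 1 < lam ->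
  forall (h : 'M[int]_2) (sig : R), G h -> h * g = g * h ->
    realmx R h *m v = sig *: v -> 1 < sig -> lam <= sig.
Proof.
move=> [Gdet GM GV _] Gg tg pg v0 ev lam1 h.
move: {2}(absz (\tr h)) (leqnn (absz (\tr h))) => n.
elim/ltn_ind: n h => n IH h hn sig Gh hg eh sig1.
rewrite leNgt; apply/negP => slam.
have [k /andP[k1 k2]] := exp_between sig1 (ltW lam1).
have GX j : G (h ^+ j.+1).
  by elim: j => [|j IHj]; rewrite ?expr1 // exprS; apply: GM.
have dh := Gdet _ Gh; have dg := Gdet _ Gg.
have s0 : 0 < sig by lra.
(* k > 0 because sig < lam, and k > 1 if lam = sig^k *)
have k0 : (0 < k)%N.
  by rewrite lt0n; apply/eqP => k0; move: k2; rewrite k0 expr1; lra.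
have Ghk : G (h ^+ k) by case: (k) k0 => [//|j _]; apply: GX.
have dhk := Gdet _ Ghk.
have skp : 0 < sig ^+ k by rewrite exprn_gt0.
pose h' := g * (h ^+ k)^-1.
have Gh' : G h' by apply: GM => //; apply: GV.
have hkg : GRing.comm (h ^+ k) g by apply: commr_sym; apply: commrX; apply: commr_sym.
have h'g : h' * g = g * h'.
  by rewrite /h' -!mulrA; congr (_ * _); apply/esym; apply: commrV; apply: commr_sym.
pose sig' := lam / sig ^+ k.
have eh' : realmx R h' *m v = sig' *: v.
  rewrite /h' realmxM (realmx_inv dhk _ (realmx_exp k eh)) ?gt_eqF //.
  by rewrite -scalemxAr ev scalerA mulrC.
have s'1 : 1 <= sig' by rewrite ler_pdivlMr // mul1r.
have s's : sig' < sig by rewrite ltr_pdivrMr // -exprS.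
have trE (w : 'M[int]_2) (s : R) : \det w = 1 -> 0 < s -> realmx R w *m v = s *: v ->
   (\tr w)%:~R = s + s^-1.
  move=> dw sp ew; have := eigen_trace dw v0 ew => e.
  apply: (mulIf (lt0r_neq0 sp)); rewrite mulrDl mulVf ?gt_eqF //; lra.
have dh' := Gdet _ Gh'.
have s'p : 0 < sig' by lra.
have th' := trE _ _ dh' s'p eh'.
have th := trE _ _ dh s0 eh.
have [s'gt|] := ltrP 1 sig'.
  have tlt : (\tr h' < \tr h).
    rewrite -(ltr_int R) th' th -subr_gt0.
    have -> : sig + sig^-1 - (sig' + sig'^-1) = (sig - sig') * (sig * sig' - 1) / (sig * sig').
      by field; rewrite !gt_eqF.
    apply: divr_gt0; last exact: mulr_gt0.
    apply: mulr_gt0; rewrite subr_gt0 //.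
    by apply: lt_trans sig1 _; rewrite ltr_pMr.
  have t0 : 0 < \tr h' by rewrite -(ltr_int R) th' addr_gt0 ?invr_gt0.
  have ab : (absz (\tr h') < n)%N.
    apply: leq_trans hn; rewrite -ltz_nat !gez0_abs ?(ltW t0) //.
    exact: ltW (lt_trans t0 tlt).
  have := IH _ ab h' (leqnn _) sig' Gh' h'g eh' s'gt; lra.
move=> s'le; have s'E : sig' = 1 by lra.
have t2 : \tr h' = 2.
  by apply: (@intr_inj R); rewrite th' s'E invr1.
have h'1 := parabolic_commuting_eq1 dg tg dh' h'g t2.
have gE : g = h ^+ k.
  by rewrite -[h ^+ k]mul1r -h'1 /h' mulrVK // det1_unit.
have lamE : lam = sig ^+ k.
  by rewrite -[lam](@divfK _ (sig ^+ k)) ?gt_eqF // -/sig' s'E mul1r.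
have k2' : (2 <= k)%N.
  by case: (k) k0 lamE => [|[|//]] // _; rewrite expr1 => e; move: slam; rewrite e ltxx.
exact: (pg h k Gh k2' gE).
Qed.

(** * The weight owned by a primitive class *)

(** Take for j the first index whose value has been met before. *)
Lemma first_repeat (F : finType) (s : nat -> F) :
  exists i j : nat, [/\ (i < j)%N, s i = s j &
    forall a b : nat, (a < j)%N -> (b < j)%N -> s a = s b -> a = b].
Proof.
pose P j := [exists i : 'I_j, s i == s j].
have exP : exists j, P j.
  apply: contrapT => nP.
  have inj : injective (fun k : 'I_#|F|.+1 => s k).
    move=> a b /= eab; apply: val_inj => /=.
    wlog ab : a b eab / (a < b)%N.
      by move=> H; have [/H->//|/H->//|//] := ltngtP a b.
    by case: nP; exists b; apply/existsP; exists (Ordinal ab); rewrite /= eab.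
  by have := leq_card _ inj; rewrite card_ord ltnn.
case: (ex_minnP exP) => j /existsP[i /eqP ij] minj.
exists i, j; split=> // a b aj bj eab.
wlog ab : a b eab aj bj / (a < b)%N.
  by move=> H; have [ab|ba|//] := ltngtP a b; [apply: H|apply/esym/H].
have : P b by apply/existsP; exists (Ordinal ab); rewrite /= eab.
by move/minj; rewrite leqNgt bj.
Qed.

Lemma posmx_entries_le (r : 'M[int]_2) : \det r = 1 -> posmx r ->
  forall i j, 0 < r i j /\ r i j <= \tr r ^+ 2.
Proof.
rewrite det2 mxtrace2 => dr /and4P[a0 b0 c0 d0].
have sq : (r 0 0 + r 1 1) ^+ 2 = r 0 0 ^+ 2 + r 1 1 ^+ 2 + 2 * (r 0 0 * r 1 1) by ring.
have aa : r 0 0 <= r 0 0 ^+ 2 by rewrite expr2 ler_peMr; lia.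
have dd : r 1 1 <= r 1 1 ^+ 2 by rewrite expr2 ler_peMr; lia.
have bb : r 0 1 <= r 0 1 * r 1 0 by rewrite ler_peMr; lia.
have cc : r 1 0 <= r 0 1 * r 1 0 by rewrite ler_peMl; lia.
have ad0 : 0 < r 0 0 * r 1 1 by rewrite mulr_gt0.
move=> i j; case: (ord2_cases i) => ->; case: (ord2_cases j) => ->; rewrite sq; split=> //; lra.
Qed.

(** The pair (r, u) stands for the conjugate r = u^-1 g u together with the
    conjugating matrix. *)
Definition walk (z : 'M[int]_2 * 'M[int]_2) : 'M[int]_2 * 'M[int]_2 :=
  (rotate z.1, z.2 * letter z.1).

Definition walk_inv (g : 'M[int]_2) (z : 'M[int]_2 * 'M[int]_2) : Prop :=
  [/\ \det z.2 = 1, posmx z.1 & z.2 * z.1 = g * z.2].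

Lemma walk_inv_det (g : 'M[int]_2) (z : 'M[int]_2 * 'M[int]_2) :
  \det g = 1 -> walk_inv g z -> \det z.1 = 1 /\ \tr z.1 = \tr g.
Proof.
move=> dg [d2 _ e].
have -> : z.1 = z.2^-1 * g * z.2 by rewrite -mulrA -e mulKr // det1_unit.
by rewrite !det1M ?det1V // mxtrace_conj.
Qed.

Lemma walk_invS (g : 'M[int]_2) (z : 'M[int]_2 * 'M[int]_2) :
  \det g = 1 -> walk_inv g z -> walk_inv g (walk z).
Proof.
move=> dg iz; have [d1 _] := walk_inv_det dg iz; case: iz => d2 p1 e.
split; rewrite /=; first by rewrite det1M ?det_letter.
  exact: posmx_rotate.
rewrite /rotate !mulrA mulrK ?det1_unit ?det_letter //.
by rewrite e.
Qed.

(** Knowing u modulo N is enough to recover the G-class of u r u^-1, and leaves only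
    finitely many pairs for a given trace. *)
Definition key_mod (N : nat) (z : 'M[int]_2 * 'M[int]_2) : 'M[int]_2 * 'M['Z_N]_2 :=
  (z.1, map_mx intr z.2).

Definition key_mod_code (B N : nat) (x : 'M[int]_2 * 'M['Z_N]_2) :
   'I_B.+1 * 'I_B.+1 * 'I_B.+1 * 'I_B.+1 * 'M['Z_N]_2 :=
  (inord (absz (x.1 0 0)), inord (absz (x.1 0 1)), inord (absz (x.1 1 0)),
   inord (absz (x.1 1 1)), x.2).

Lemma key_mod_code_inj (B N : nat) (x y : 'M[int]_2 * 'M['Z_N]_2) :
  (forall i j, 0 < x.1 i j /\ x.1 i j <= B%:Z) ->
  (forall i j, 0 < y.1 i j /\ y.1 i j <= B%:Z) ->
  key_mod_code B x = key_mod_code B y -> x = y.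
Proof.
move=> hx hy [/(congr1 (@nat_of_ord _)) E1 /(congr1 (@nat_of_ord _)) E2
  /(congr1 (@nat_of_ord _)) E3 /(congr1 (@nat_of_ord _)) E4 E5].
have bx i j : (absz (x.1 i j) < B.+1)%N by have := hx i j; lia.
have by_ i j : (absz (y.1 i j) < B.+1)%N by have := hy i j; lia.
move: E1 E2 E3 E4; rewrite !inordK // => E1 E2 E3 E4.
rewrite (surjective_pairing x) (surjective_pairing y) E5; congr (_, _).
apply: eq_mx2.
- by have := hx 0 0; have := hy 0 0; lia.
- by have := hx 0 1; have := hy 0 1; lia.
- by have := hx 1 0; have := hy 1 0; lia.
- by have := hx 1 1; have := hy 1 1; lia.
Qed.

(** The eigenvector is (b, lam - a); its second coordinate is positive since
    lam (lam - a) = d lam - 1. *)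
Lemma pos_eigenvector (R : realType) (r : 'M[int]_2) (lam : R) :
  \det r = 1 -> posmx r -> lam ^+ 2 - (\tr r)%:~R * lam + 1 = 0 -> 1 < lam ->
  exists v : 'cV[R]_2, poscv v /\ realmx R r *m v = lam *: v.
Proof.
move=> dr /and4P[a0 b0 c0 d0]; rewrite mxtrace2 rmorphD /= => el l1.
pose v : 'cV[R]_2 := \col_i (if i == 0 then (r 0 1)%:~R else lam - (r 0 0)%:~R).
have dR : (r 0 0)%:~R * (r 1 1)%:~R - (r 0 1)%:~R * (r 1 0)%:~R = 1 :> R.
  by rewrite -!intrM -rmorphB /= -det2 dr.
have d1 : 1 <= (r 1 1)%:~R :> R by rewrite -[1]/(1%:~R) ler_int.
have b0' : 0 < (r 0 1)%:~R :> R by rewrite ltr0z.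
exists v; split; last first.
  apply: cv2P; rewrite mulmx2E !mxE /=; first by ring.
  move: dR el; move: ((r 0 0)%:~R : R) ((r 0 1)%:~R : R) ((r 1 0)%:~R : R)
    ((r 1 1)%:~R : R) => a b c d dR el.
  lra.
rewrite /poscv !mxE /= b0' /= subr_gt0.
move: el; move: ((r 0 0)%:~R : R) ((r 1 1)%:~R : R) d1 => a d d1 el.
have e2 : lam * (lam - a) = d * lam - 1 by lra.
have : 0 < lam * (lam - a) by rewrite e2; nra.
by rewrite pmulr_rgt0 ?subr_gt0 //; lra.
Qed.

Lemma eigen_proportional (R : realType) (r : 'M[int]_2) (v w : 'cV[R]_2) (lam : R) :
  posmx r -> poscv v -> poscv w ->
  realmx R r *m v = lam *: v -> realmx R r *m w = lam *: w ->
  exists s : R, 0 < s /\ v = s *: w.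
Proof.
move=> /and4P[a0 b0 c0 d0] /andP[v0 v1] /andP[w0 w1] /eigen_eqs[ev _] /eigen_eqs[ew _].
exists (v 0 0 / w 0 0); split; first by rewrite divr_gt0.
apply: cv2P; rewrite mxE; first by rewrite divfK ?gt_eqF.
have b0' : (r 0 1)%:~R != 0 :> R by rewrite intr_eq0 gt_eqF.
apply: (mulfI b0').
have -> : (r 0 1)%:~R * v 1 0 = (lam - (r 0 0)%:~R) * v 0 0 by rewrite mulrBl -ev; ring.
have -> : (r 0 1)%:~R * (v 0 0 / w 0 0 * w 1 0) = (v 0 0 / w 0 0) * ((r 0 1)%:~R * w 1 0) by ring.
have -> : (r 0 1)%:~R * w 1 0 = (lam - (r 0 0)%:~R) * w 0 0 by rewrite mulrBl -ew; ring.
by rewrite mulrCA divfK ?gt_eqF.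
Qed.

Lemma ln_height_step (R : realType) (a b w : R) : 0 < b -> b < a -> a - b <= w * b ->
  ln a - ln b <= w.
Proof.
move=> b0 ba h; have a0 : 0 < a by lra.
rewrite -ln_div ?posrE //.
have ab1 : 1 < a / b by rewrite ltr_pdivlMr // mul1r.
have -> : a / b = 1 + (a / b - 1) by ring.
apply: le_trans (le_ln1Dx _) _; first by lra.
by rewrite lerBlDr ler_pdivrMr // mulrDl mul1r; lra.
Qed.

(** Follow the walk from a positive conjugate of g until a pair (r, u mod N) is met
    again, at times i < j.  Then h = u_j u_i^-1 lies in G, commutes with g, and
    dilates the eigenvector V of g by |v_i| / |v_j|, where v_n = u_n^-1 V.  So
    log lam <= log |v_i| - log |v_j|, and this telescopes into the weights of the
    pairs met between i and j, which are distinct. *)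
Lemma class_weight (R : realType) (N : nat) (G : set 'M[int]_2)
  (g : 'M[int]_2) (lam : R) :
  cong_group N G -> G g -> 2 < \tr g -> primitive_in G g ->
  lam ^+ 2 - (\tr g)%:~R * lam + 1 = 0 -> 1 < lam ->
  exists s : seq ('M[int]_2 * 'M['Z_N]_2), [/\ uniq s,
    forall x, x \in s -> exists u : 'M[int]_2,
      walk_inv g (x.1, u) /\ x.2 = map_mx intr u &
    ln lam <= \sum_(x <- s) weight R x.1].
Proof.
move=> cG Gg tg pg el l1; case: (cG) => Gdet GM GV GN.
have dg := Gdet _ Gg.
have [u0 [du0 pr0]] := hyperbolic_conj_pos dg tg.
pose z0 := (u0^-1 * g * u0, u0).
have iz0 : walk_inv g z0.
  by split=> //=; rewrite !mulrA divrr ?mul1r // det1_unit.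
pose z n := iter n walk z0.
have iz n : walk_inv g (z n) by elim: n => [//|n IH]; apply: walk_invS.
have dz n : \det (z n).1 = 1 /\ \tr (z n).1 = \tr g := walk_inv_det dg (iz n).
have l0 : 0 < lam by lra.
have lt : lam < (\tr g)%:~R.
  rewrite -subr_gt0 -(pmulr_rgt0 _ l0) (_ : _ * _ = 1) //; lra.
have [v0 [pv0 ev0]] : exists v : 'cV[R]_2, poscv v /\ realmx R (z 0).1 *m v = lam *: v.
  by apply: pos_eigenvector => //; rewrite ?(dz 0).1 ?(dz 0).2.
(* V is an eigenvector of g, and v n is V seen in the frame of z n *)
pose V := realmx R u0 *m v0.
have eV : realmx R g *m V = lam *: V.
  rewrite /V -realmxM; case: (iz 0) => _ _ /= <-.
  by rewrite realmxM ev0 -scalemxAr.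
pose v n := realmx R (z n).2^-1 *m V.
have ev n : realmx R (z n).1 *m v n = lam *: v n.
  case: (iz n) => d2 _ e.
  rewrite /v -realmxM.
  have -> : (z n).1 * (z n).2^-1 = (z n).2^-1 * g.
    apply: (mulrI (det1_unit d2)). rewrite [LHS]mulrA e mulrK ?det1_unit //.
    by rewrite mulVKr ?det1_unit.
  by rewrite realmxM eV -scalemxAr.
have vS n : v n.+1 = realmx R (letter (z n).1)^-1 *m v n.
  rewrite /v /= invrM ?det1_unit ?det_letter ?realmxM //.
  by case: (iz n).
have pv n : poscv (v n).
  elim: n => [|n IH]; first by rewrite /v /V realmxK.
  have [d1 t1] := dz n; rewrite vS.
  by case: (rotate_vec d1 _ IH (ev n) l0); rewrite ?t1 //; case: (iz n).
have step n : height (v n.+1) < height (v n) /\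
    height (v n) - height (v n.+1) <= weight R (z n).1 * height (v n.+1).
  have [d1 t1] := dz n; rewrite vS.
  by case: (rotate_vec d1 _ (pv n) (ev n) l0); rewrite ?t1 //; case: (iz n).
have hp n : 0 < height (v n) by case/andP: (pv n) => h1 h2; rewrite /height addr_gt0.
have tele i j : (i <= j)%N ->
    ln (height (v i)) - ln (height (v j)) <= \sum_(i <= k < j) weight R (z k).1.
  move=> ij; rewrite -(subnKC ij); elim: (j - i)%N => [|m IH].
    by rewrite addn0 big_geq // subrr.
  rewrite addnS big_nat_recr ?leq_addr //=.
  have [s1 s2] := step (i + m)%N.
  have := ln_height_step (hp _) s1 s2; lra.
have decr i j : (i < j)%N -> height (v j) < height (v i).
  move=> ij; rewrite -(subnKC ij); elim: (j - i.+1)%N => [|m IH].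
    by rewrite addn0; case: (step i).
  by rewrite addnS; apply: lt_trans IH; case: (step (i.+1 + m)%N).
pose B := absz (\tr g ^+ 2).
have bz n : forall a b, 0 < (z n).1 a b /\ (z n).1 a b <= B%:Z.
  have [d1 t1] := dz n; move=> a b.
  have [] := @posmx_entries_le (z n).1 d1 _ a b; first by case: (iz n).
  by rewrite t1 => h1 h2; split=> //; rewrite /B gez0_abs // sqr_ge0.
have [i [j [ij sij inj]]] := first_repeat (fun n => key_mod_code B (key_mod N (z n))).
have kij : key_mod N (z i) = key_mod N (z j) by apply: key_mod_code_inj sij; apply: bz.
have [zE uE] : (z i).1 = (z j).1 /\ map_mx intr (z i).2 = map_mx intr (z j).2 :> 'M['Z_N]_2.
  by case: kij.
exists [seq key_mod N (z k) | k <- index_iota i j]; split.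
- rewrite map_inj_in_uniq ?iota_uniq // => a b.
  rewrite !mem_index_iota => /andP[_ aj] /andP[_ bj] eab.
  by apply: inj => //; rewrite eab.
- move=> x /mapP[k _ ->]; exists (z k).2; split=> //=.
  by rewrite -surjective_pairing.
rewrite big_map /=; apply: le_trans (tele _ _ (ltnW ij)).
have [di pi ei] := iz i; have [dj pj ej] := iz j.
have [sig [sig0 vsig]] : exists s : R, 0 < s /\ v i = s *: v j.
  by apply: (@eigen_proportional _ (z i).1 _ _ lam); rewrite // zE.
have hsig : height (v i) = sig * height (v j).
  by rewrite vsig /height !mxE mulrDr.
have sig1 : 1 < sig.
  by have := decr _ _ ij; rewrite hsig ltr_pMl.
rewrite hsig lnM ?posrE // addrK ler_ln ?posrE //.
pose h := (z j).2 * (z i).2^-1.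
have dh : \det h = 1 by rewrite det1M ?det1V.
have Gh : G h.
  apply: GN => //; rewrite /h -[_ * _]/(_ *m _) map_mxM -uE -map_mxM.
  by rewrite -[_ *m _]/((z i).2 * (z i).2^-1) divrr ?det1_unit // map_mx1.
have hg : h * g = g * h.
  rewrite /h [RHS]mulrA -ej -zE -!mulrA; congr (_ * _).
  apply: (mulrI (det1_unit di)); rewrite mulVKr ?det1_unit // mulrA ei.
  by rewrite mulrK ?det1_unit.
have eh : realmx R h *m V = sig *: V.
  rewrite /h realmxM -/(v i) vsig -scalemxAr /v realmxVK //.
have V0 : V != 0.
  apply/eqP => V0; have := pv 0; rewrite /v V0 mulmx0 /poscv mxE ltxx //.
exact: (primitive_minimal cG Gg tg pg V0 eV l1 Gh hg eh sig1).
Qed.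

(** * The total weight of positive matrices *)

(** Each pair (n, m) is hit at most once for each value of k. *)
Lemma sum_pairs_le (R : realFieldType) (t : nat) (F : finType) (T : eqType)
  (s : seq T) (P : pred T) (n m : T -> nat) (k : T -> F) :
  uniq s ->
  (forall x, x \in s -> P x ->
     [/\ (0 < n x)%N, (n x <= m x)%N, (m x <= t)%N & qroot t (n x) (m x)]) ->
  (forall x y, x \in s -> y \in s -> n x = n y -> m x = m y -> k x = k y -> x = y) ->
  \sum_(x <- s | P x) (n x)%:R / (m x)%:R <= #|F|%:R * root_ratio_sum R t :> R.
Proof.
move=> us hs inj.
pose phi x : 'I_t.+1 * 'I_t.+1 * F := (inord (n x), inord (m x), k x).
pose Gv (y : 'I_t.+1 * 'I_t.+1 * F) : R := y.1.1%:R / y.1.2%:R.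
pose C (y : 'I_t.+1 * 'I_t.+1) := [&& (0 < y.1)%N, (y.1 <= y.2)%N & qroot t y.1 y.2].
have hphi x : x \in [seq x <- s | P x] ->
   [/\ (phi x).1.1 = n x :> nat, (phi x).1.2 = m x :> nat, x \in s & C (phi x).1].
  rewrite mem_filter => /andP[Px xs]; have [h1 h2 h3 h4] := hs x xs Px.
  have mt : (m x < t.+1)%N by [].
  have nt : (n x < t.+1)%N by apply: leq_ltn_trans mt.
  by rewrite /C /phi /= !inordK // h1 h2 h4.
have -> : \sum_(x <- s | P x) (n x)%:R / (m x)%:R =
    \sum_(y <- [seq phi x | x <- s & P x]) Gv y.
  rewrite big_map -[LHS]big_filter; apply: eq_big_seq => x /hphi[e1 e2 _ _].
  by rewrite /Gv e1 e2.
rewrite big_uniq /=; last first.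
  rewrite map_inj_in_uniq ?filter_uniq // => x y hx hy e.
  have [x1 x2 xs _] := hphi x hx; have [y1 y2 ys _] := hphi y hy.
  by apply: inj => //; rewrite -?x1 -?x2 -?y1 -?y2 ?e //; case: e.
have -> : #|F|%:R * root_ratio_sum R t = \sum_(y : 'I_t.+1 * 'I_t.+1 * F | C y.1) Gv y.
  rewrite /root_ratio_sum mulr_sumr.
  transitivity (\sum_(p : 'I_t.+1 * 'I_t.+1 | C p) \sum_(u : F) Gv (p, u)).
    apply: eq_bigr => p _; rewrite -sum1_card natr_sum mulr_suml.
    by apply: eq_big => // u _; rewrite mul1r.
  by rewrite pair_big_dep /=; apply: eq_big => [[p u]|[p u] _] //=; rewrite andbT.
rewrite big_mkcond [leRHS]big_mkcond /=; apply: ler_sum => y _.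
case: ifP => [/mapP[x /hphi[_ _ _ Cx] ->]|_]; first by rewrite Cx.
by case: ifP => // _; rewrite /Gv divr_ge0.
Qed.

(** Since a d = 1 + b c <= 2 b c, one has d / b <= 2 c / a and a / c <= 2 b / d.  If
    the first row dominates, then c <= a and the first bound applies; otherwise
    b <= d and the second one does. *)
Lemma weight_le (R : realType) (r : 'M[int]_2) : \det r = 1 -> posmx r ->
  weight R r <= (if r 1 0 <= r 0 0 then 2 * ((absz (r 1 0))%:R / (absz (r 0 0))%:R) else 0)
          + (if r 0 1 <= r 1 1 then 2 * ((absz (r 0 1))%:R / (absz (r 1 1))%:R) else 0).
Proof.
move=> dr pr; have rd := row_dominance dr pr.
case/and4P: pr => a0 b0 c0 d0.
have absE (k : int) : 0 < k -> (absz k)%:R = k%:~R :> R.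
  by move=> k0; rewrite -[in RHS](gtz0_abs k0).
rewrite !absE //.
have dR : (r 0 0)%:~R * (r 1 1)%:~R = 1 + (r 0 1)%:~R * (r 1 0)%:~R :> R.
  by rewrite -!intrM -[1]/(1%:~R) -intrD; congr (_%:~R); rewrite -dr det2; ring.
have bc1 : 1 <= (r 0 1)%:~R * (r 1 0)%:~R :> R.
  by rewrite -intrM -[1]/(1%:~R) ler_int; have := mulr_gt0 b0 c0; lia.
have [A0 [B0 [C0 D0]]] : (0 < (r 0 0)%:~R :> R /\ 0 < (r 0 1)%:~R :> R /\
   0 < (r 1 0)%:~R :> R /\ 0 < (r 1 1)%:~R :> R).
  by rewrite !ltr0z.
have t1 : (r 1 1)%:~R / (r 0 1)%:~R <= 2 * ((r 1 0)%:~R / (r 0 0)%:~R) :> R.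
  rewrite mulrA ler_pdivlMr // mulrAC ler_pdivrMr //; lra.
have t2 : (r 0 0)%:~R / (r 1 0)%:~R <= 2 * ((r 0 1)%:~R / (r 1 1)%:~R) :> R.
  rewrite mulrA ler_pdivlMr // mulrAC ler_pdivrMr //; lra.
have p1 : 0 <= (r 1 0)%:~R / (r 0 0)%:~R :> R by rewrite divr_ge0 // ltW.
have p2 : 0 <= (r 0 1)%:~R / (r 1 1)%:~R :> R by rewrite divr_ge0 // ltW.
have [m1 m2] : weight R r <= (r 1 1)%:~R / (r 0 1)%:~R /\ weight R r <= (r 0 0)%:~R / (r 1 0)%:~R.
  by rewrite /weight !ge_min !lexx orbT.
case: rd => [[_ h]|[h _]].
  rewrite (ltW h); apply: le_trans m1 _.
  apply: le_trans t1 _; rewrite lerDl; case: ifP => // _; lra.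
rewrite (ltW h); apply: le_trans m2 _.
apply: le_trans t2 _; rewrite lerDr; case: ifP => // _; lra.
Qed.

(** A positive matrix of trace t is determined by its first column (a, c), and by
    (d, b) as well.  Here a t = a^2 + 1 + b c, so a is a root modulo c, and likewise
    d is a root modulo b. *)
Lemma sum_weight_le (R : realType) (t : nat) (F : finType)
  (s : seq ('M[int]_2 * F)) : uniq s ->
  (forall x, x \in s -> [/\ \det x.1 = 1, posmx x.1 & \tr x.1 = t%:Z]) ->
  \sum_(x <- s) weight R x.1 <= 4 * #|F|%:R * root_ratio_sum R t.
Proof.
move=> us hs.
apply: le_trans (_ : \sum_(x <- s)
   ((if x.1 1 0 <= x.1 0 0 then 2 * ((absz (x.1 1 0))%:R / (absz (x.1 0 0))%:R) else 0)
    + (if x.1 0 1 <= x.1 1 1 then 2 * ((absz (x.1 0 1))%:R / (absz (x.1 1 1))%:R) else 0)) <= _).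
  rewrite big_seq [leRHS]big_seq; apply: ler_sum => x /hs[d1 p1 _]; exact: weight_le.
rewrite big_split /= -!big_mkcond /= -!mulr_sumr.
have entries x : x \in s -> exists a b c d : nat,
    [/\ x.1 = mx2 a%:Z b%:Z c%:Z d%:Z, [&& 0 < a, 0 < b, 0 < c & 0 < d]%N,
        (a * d = b * c + 1)%N & (a + d = t)%N].
  move=> /hs[d1 /and4P[a0 b0 c0 d0] t1].
  exists (absz (x.1 0 0)), (absz (x.1 0 1)), (absz (x.1 1 0)), (absz (x.1 1 1)).
  move: d1 t1; rewrite det2 mxtrace2 => d1 t1; split.
  - by apply: eq_mx2; rewrite !mxE /= gtz0_abs.
  - by rewrite !absz_gt0 !gt_eqF.
  - by apply/eqP; rewrite -eqz_nat PoszD !PoszM !gtz0_abs //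
      -[1%N%:Z]/(1 : int) -d1 addrC subrK.
  - by apply/eqP; rewrite -eqz_nat PoszD !gtz0_abs // t1.
have hL := @sum_pairs_le R t F _ s (fun x => x.1 1 0 <= x.1 0 0)
  (fun x => absz (x.1 1 0)) (fun x => absz (x.1 0 0)) (fun x => x.2) us.
have hR := @sum_pairs_le R t F _ s (fun x => x.1 0 1 <= x.1 1 1)
  (fun x => absz (x.1 0 1)) (fun x => absz (x.1 1 1)) (fun x => x.2) us.
rewrite (_ : 4 * _ * _ = 2 * (#|F|%:R * root_ratio_sum R t) + 2 * (#|F|%:R * root_ratio_sum R t));
  last by ring.
apply: lerD; rewrite ler_pM2l //.
  apply: hL.
    move=> x /entries[a [b [c [d [-> /and4P[a0 b0 c0 d0] ad tE]]]]]; rewrite !mxE /= => ca.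
    split=> //; first by lia.
    rewrite /qroot -tE mulnDr ad.
    by rewrite addnA addnAC addnC modnMDl.
  move=> x y /entries[a [b [c [d [xE /and4P[a0 b0 c0 d0] ad tE]]]]].
  move=> /entries[a' [b' [c' [d' [yE /and4P[a0' b0' c0' d0'] ad' tE']]]]].
  rewrite xE yE !mxE /= => ec ea ek.
  rewrite (surjective_pairing x) (surjective_pairing y) ek; congr (_, _).
  rewrite xE yE; subst c' a'; have ed : d = d' by lia.
  subst d'; have eb : b = b'.
    by apply/eqP; rewrite -(eqn_pmul2r c0); apply/eqP; lia.
  by subst b'.
apply: hR.
  move=> x /entries[a [b [c [d [-> /and4P[a0 b0 c0 d0] ad tE]]]]]; rewrite !mxE /= => ca.
  split=> //; first by lia.
  rewrite /qroot -tE mulnDr [(d * a)%N]mulnC ad [(b * c)%N]mulnC.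
  by rewrite -addnA [(1 + _)%N]addnC modnMDl.
move=> x y /entries[a [b [c [d [xE /and4P[a0 b0 c0 d0] ad tE]]]]].
move=> /entries[a' [b' [c' [d' [yE /and4P[a0' b0' c0' d0'] ad' tE']]]]].
rewrite xE yE !mxE /= => ec ea ek.
rewrite (surjective_pairing x) (surjective_pairing y) ek; congr (_, _).
rewrite xE yE; subst b' d'; have ed : a = a' by lia.
subst a'; have eb : c = c'.
  by apply/eqP; rewrite -(eqn_pmul2l b0); apply/eqP; lia.
by subst c'.
Qed.

(** * Congruence subgroups and classes of a given trace *)

Lemma eqz_mod_Zp (N : nat) (a b : int) : (1 < N)%N ->
  (a = b %[mod N])%Z <-> (a%:~R = b%:~R :> 'Z_N).
Proof.
move=> N1.
have red (k : int) : k%:~R = (absz (k %% N)%Z)%:R :> 'Z_N.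
  rewrite {1}(divz_eq k N) intrD intrM -[(Posz N)%:~R]/(N%:R : 'Z_N) pchar_Zp // mulr0 add0r.
  by rewrite -[in LHS](@gez0_abs (k %% N)%Z) ?modz_ge0 //; lia.
rewrite !red; split=> [->//|h].
have := congr1 (fun z : 'Z_N => nat_of_ord z) h.
rewrite /= !val_Zp_nat //.
have la := @ltz_pmod a N ltac:(lia). have lb := @ltz_pmod b N ltac:(lia).
have ga := @modz_ge0 a N ltac:(lia). have gb := @modz_ge0 b N ltac:(lia).
rewrite !modn_small; lia.
Qed.

Definition diag_pm1R (R : comNzRingType) (A : 'M[R]_2) : Prop :=
  A 0 0 = A 1 1 /\ (A 1 1 = 1 \/ A 1 1 = -1).

Lemma diag_pm1E (N : nat) (g : 'M[int]_2) : (1 < N)%N ->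
  diag_pm1 N g <-> diag_pm1R (map_mx intr g : 'M['Z_N]_2).
Proof.
move=> N1; rewrite /diag_pm1 /diag_pm1R !mxE.
rewrite -[1 in X in _ <-> X]/(1%:~R) -rmorphN /=.
by rewrite !eqz_mod_Zp.
Qed.

(** A group cut out of SL_2(Z) by a condition P on the reduction modulo N; the
    last closure property is stability under the adjugate. *)
Lemma cong_groupP (N : nat) (P : 'M['Z_N]_2 -> Prop) (G : set 'M[int]_2) :
  (forall g, G g <-> \det g = 1 /\ P (map_mx intr g)) ->
  P 1 -> (forall A B, P A -> P B -> P (A * B)) ->
  (forall a b c d, P (mx2 a b c d) -> P (mx2 d (- b) (- c) a)) ->
  cong_group N G.
Proof.
move=> GE P1 PM PV; split.
- by move=> g /GE[].
- move=> g h /GE[dg Pg] /GE[dh Ph]; apply/GE; split; first exact: det1M.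
  by rewrite -[g * h]/(g *m h) map_mxM; apply: PM.
- move=> g /GE[dg Pg]; apply/GE; split; first exact: det1V.
  rewrite inv_mx2 //.
  have -> : map_mx intr (mx2 (g 1 1) (- g 0 1) (- g 1 0) (g 0 0)) =
     mx2 (g 1 1)%:~R (- (g 0 1)%:~R) (- (g 1 0)%:~R) (g 0 0)%:~R :> 'M['Z_N]_2.
    by apply: eq_mx2; rewrite !mxE //= rmorphN.
  apply: PV; move: Pg; congr P; apply: eq_mx2; rewrite !mxE //.
by move=> g dg g1; apply/GE; rewrite g1.
Qed.

Lemma eqz_mod0_Zp (N : nat) (a : int) : (1 < N)%N ->
  (a = 0 %[mod N])%Z <-> (a%:~R = 0 :> 'Z_N).
Proof. by move=> N1; rewrite eqz_mod_Zp. Qed.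

Lemma cong_group_Gamma (N : nat) (G : set 'M[int]_2) : (1 < N)%N ->
  G = Gamma0 N \/ G = Gamma1 N \/ G = GammaN N -> cong_group N G.
Proof.
move=> N1.
have pmM (a b c d : 'Z_N) : a = c -> b = d -> (c = 1 \/ c = -1) -> (d = 1 \/ d = -1) ->
    a * b = c * d /\ (c * d = 1 \/ c * d = -1).
  move=> -> -> [->|->] [->|->]; split=> //; rewrite ?mulrNN ?mulr1 ?mul1r; by [left|right].
case=> [->|[->|->]].
- apply: (@cong_groupP N (fun A => A 1 0 = 0)).
  + by move=> g; rewrite /Gamma0 /= eqz_mod0_Zp // mxE.
  + by rewrite mxE.
  + by move=> A B hA hB; rewrite mulr2E hA hB mul0r mulr0 addr0.
  + by move=> a b c d; rewrite !mxE /= => ->; rewrite oppr0.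
- apply: (@cong_groupP N (fun A => diag_pm1R A /\ A 1 0 = 0)).
  + move=> g; rewrite /Gamma1 /= -diag_pm1E // mxE -eqz_mod0_Zp //.
    by split=> [[? ? ?]|[? [? ?]]].
  + by split; rewrite ?mxE //; split; rewrite !mxE //; left.
  + move=> A B [[a1 a2] a3] [[b1 b2] b3]; split; last first.
      by rewrite mulr2E a3 b3 mul0r mulr0 addr0.
    rewrite /diag_pm1R !mulr2E a3 b3 mulr0 mul0r addr0 add0r; exact: pmM.
  + move=> a b c d; rewrite /diag_pm1R !mxE /= => -[[-> h] ->]; rewrite oppr0.
    by [].
- apply: (@cong_groupP N (fun A => diag_pm1R A /\ A 1 0 = 0 /\ A 0 1 = 0)).
  + move=> g; rewrite /GammaN /= -diag_pm1E // !mxE -!eqz_mod0_Zp //.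
    by split=> [[? ? ? ?]|[? [? [? ?]]]].
  + by split; rewrite ?mxE //; split; rewrite !mxE //; left.
  + move=> A B [[a1 a2] [a3 a4]] [[b1 b2] [b3 b4]]; split.
      rewrite /diag_pm1R !mulr2E a3 b3 a4 !mul0r addr0 add0r; exact: pmM.
    by rewrite !mulr2E a3 b3 a4 b4 !mul0r !mulr0 !addr0.
  + move=> a b c d; rewrite /diag_pm1R !mxE /= => -[[-> h] [-> ->]]; rewrite oppr0.
    by [].
Qed.

Lemma conj_class_conj (N : nat) (G : set 'M[int]_2) (g k : 'M[int]_2) :
  cong_group N G -> G k -> conj_class G (k * g * k^-1) = conj_class G g.
Proof.
move=> [Gdet GM GV _] Gk.
have uk := det1_unit (Gdet _ Gk).
apply/seteqP; split=> x [h Gh <-].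
  exists (h * k); first exact: GM.
  by rewrite invrM ?(det1_unit (Gdet _ Gh)) // !mulrA.
exists (h * k^-1); first by apply: GM => //; apply: GV.
rewrite invrM ?unitrV ?(det1_unit (Gdet _ Gh)) // invrK !mulrA.
by rewrite !mulrVK // -?unitrV // !mulrA mulrVK.
Qed.

(** The pairs owned by the class K. *)
Definition lies_over (N : nat) (G : set 'M[int]_2) (t : nat) (K : set 'M[int]_2)
  (x : 'M[int]_2 * 'M['Z_N]_2) : Prop :=
  [/\ \det x.1 = 1, posmx x.1, \tr x.1 = t%:Z &
   exists u : 'M[int]_2, [/\ \det u = 1, x.2 = map_mx intr u &
     K = conj_class G (u * x.1 * u^-1)]].

(** If u and w agree modulo N then u w^-1 is in G, and it conjugates w r w^-1 to
    u r u^-1. *)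
Lemma lies_over_inj (N : nat) (G : set 'M[int]_2) (t : nat) (K K' : set 'M[int]_2)
  (x : 'M[int]_2 * 'M['Z_N]_2) : cong_group N G ->
  lies_over G t K x -> lies_over G t K' x -> K = K'.
Proof.
move=> cG [dx _ _ [u [du xu ->]]] [_ _ _ [w [dw xw ->]]].
case: (cG) => _ _ _ GN.
have Gk : G (u * w^-1).
  apply: GN; first by rewrite det1M ?det1V.
  rewrite -[_ * _]/(_ *m _) map_mxM -xu xw -map_mxM.
  by rewrite -[_ *m _]/(w * w^-1) divrr ?det1_unit // map_mx1.
rewrite -(conj_class_conj (w * x.1 * w^-1) cG Gk); congr (conj_class G _).
rewrite invrM ?unitrV ?det1_unit // invrK !mulrA.
by rewrite !mulrVK ?det1_unit.
Qed.

(** Concatenating the lists of pairs owned by the classes gives a list without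
    repetition. *)
Lemma count_classes_trace_weighted (R : realType) (N : nat) (G : set 'M[int]_2) (t : nat)
  (lam : R) (Ks : seq (set 'M[int]_2)) :
  cong_group N G -> (2 < t)%N -> lam ^+ 2 - t%:R * lam + 1 = 0 -> 1 < lam ->
  uniq Ks ->
  (forall K, K \in Ks -> exists g, [/\ G g, \tr g = t%:Z, primitive_in G g &
     K = conj_class G g]) ->
  (size Ks)%:R * ln lam <= 4 * #|{: 'M['Z_N]_2}|%:R * root_ratio_sum R t.
Proof.
move=> cG t2 el l1 uK hK.
suff [Z [uZ hZ lZ]] : exists Z : seq ('M[int]_2 * 'M['Z_N]_2), [/\ uniq Z,
    (forall x, x \in Z -> exists2 K, K \in Ks & lies_over G t K x) &
    (size Ks)%:R * ln lam <= \sum_(x <- Z) weight R x.1].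
  apply: le_trans lZ _; apply: sum_weight_le => // x /hZ[K _ [d1 p1 t1 _]]; by split.
elim: Ks uK hK => [|K Ks IH] /= uK hK.
  by exists [::]; split=> //; rewrite big_nil mul0r.
case/andP: uK => nK uK.
have [|Z [uZ hZ lZ]] := IH uK.
  by move=> K' K's; apply: hK; rewrite inE K's orbT.
have [g [Gg tg pg KE]] := hK K (mem_head _ _).
case: (cG) => Gdet _ _ _; have dg := Gdet _ Gg.
have [||s [us hs ls]] := class_weight cG Gg _ pg _ l1.
- by rewrite tg; lia.
- by rewrite tg.
have hs' x : x \in s -> lies_over G t K x.
  move=> /hs[u [iu xu]]; have [d1 t1] := walk_inv_det dg iu.
  case: iu => /= du px e; split=> //; first by rewrite t1.
  exists u; split=> //; rewrite KE; congr (conj_class G _).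
  by rewrite e mulrK ?det1_unit.
exists (s ++ Z); split.
- rewrite cat_uniq us uZ andbT /=; apply/hasPn => x /hZ[K' K's ox].
  apply/negP => /hs' ox'; case/negP: nK.
  by rewrite (lies_over_inj cG ox' ox).
- move=> x; rewrite mem_cat => /orP[/hs' ox|/hZ[K' K's ox]].
    by exists K => //; rewrite mem_head.
  by exists K' => //; rewrite inE K's orbT.
by rewrite big_cat /= -natr1 mulrDl mul1r addrC lerD.
Qed.

(** * The interval of norms *)

Lemma ln_ge_1BV (R : realType) (x : R) : 0 < x -> 1 - x^-1 <= ln x.
Proof.
move=> x0; have xi : 0 < x^-1 by rewrite invr_gt0.
have := @le_ln1Dx R (x^-1 - 1) ltac:(lra).
by rewrite addrC subrK lnV ?posrE //; lra.
Qed.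

Lemma harmonic_sum_le_ln (R : realType) (n : nat) : (0 < n)%N -> harmonic_sum R n <= 1 + ln n%:R.
Proof.
case: n => // n _; elim: n => [|n IH].
  by rewrite /harmonic_sum !big_ord_recr big_ord0 /= invr0 invr1 ln1; lra.
have -> : harmonic_sum R n.+2 = harmonic_sum R n.+1 + n.+2%:R^-1.
  by rewrite /harmonic_sum big_ord_recr.
have n1 : 0 < n.+1%:R :> R by rewrite ltr0n.
have n2 : 0 < n.+2%:R :> R by rewrite ltr0n.
have := @ln_ge_1BV R (n.+2%:R / n.+1%:R) (divr_gt0 n2 n1).
rewrite invf_div ln_div ?posrE //.
have -> : 1 - n.+1%:R / n.+2%:R = n.+2%:R^-1 :> R.
  have e : n.+2%:R = n.+1%:R + 1 :> R by rewrite natr1.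
  by move: n2; rewrite e => n2; field; rewrite gt_eqF.
move: IH; set p := ln n.+1%:R; set q := ln _; set i := _^-1; set h := harmonic_sum _ _; lra.
Qed.

(** The larger root lam of X^2 - t X + 1. *)
Definition dilation (R : realType) (t : nat) : R :=
  (t%:R + Num.sqrt (t%:R ^+ 2 - 4)) / 2.

Lemma dilation_facts (R : realType) (t : nat) : (2 < t)%N ->
  let lam := dilation R t in
  [/\ lam ^+ 2 - t%:R * lam + 1 = 0, 1 < lam, lam < t%:R & t%:R - 1 < lam].
Proof.
move=> t2 lam.
have t3 : 3 <= t%:R :> R by rewrite (ler_nat _ 3).
have D0 : 0 <= t%:R ^+ 2 - 4 :> R by nra.
have s2 := sqr_sqrtr D0.
have s0 : 0 <= Num.sqrt (t%:R ^+ 2 - 4) :> R by apply: sqrtr_ge0.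
rewrite /lam /dilation; move: s2 s0; set s := Num.sqrt _ => s2 s0.
have h1 : t%:R - 2 < s.
  rewrite ltNge; apply/negP => h; have : s ^+ 2 <= (t%:R - 2) ^+ 2 by rewrite ler_sqr ?nnegrE; lra.
  rewrite s2; nra.
have h2 : s < t%:R.
  rewrite ltNge; apply/negP => h; have : t%:R ^+ 2 <= s ^+ 2 by rewrite ler_sqr ?nnegrE; lra.
  rewrite s2; lra.
split; [|lra|lra|lra].
rewrite (_ : _ - _ + 1 = (s ^+ 2 - (t%:R ^+ 2 - 4)) / 4); last by field.
by rewrite s2 subrr mul0r.
Qed.

Lemma eigenvalue2E (R : realType) (g : 'M[int]_2) (a : R) : \det g = 1 ->
  eigenvalue (map_mx intr g : 'M[R]_2) a <-> a ^+ 2 - (\tr g)%:~R * a + 1 = 0.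
Proof.
move=> dg; rewrite eigenvalue_root_char /root /char_poly det2 !mxE /=.
rewrite !mulr0n !mulr1n !sub0r !hornerE /=.
have dR : (g 0 0)%:~R * (g 1 1)%:~R - (g 0 1)%:~R * (g 1 0)%:~R = 1 :> R.
  by rewrite -!intrM -rmorphB /= -det2 dg.
rewrite mxtrace2 rmorphD /=; move: dR.
move: ((g 0 0)%:~R : R) ((g 0 1)%:~R : R) ((g 1 0)%:~R : R) ((g 1 1)%:~R : R) => b c d e dR.
have -> : (a - b) * (a - e) - - c * - d = a ^+ 2 - (b + e) * a + (b * e - c * d) by ring.
by rewrite dR; split=> [/eqP|->].
Qed.

(** The eigenvalues are lam and t - lam = 1 / lam < lam. *)
Lemma hyp_normE (R : realType) (g : 'M[int]_2) (t : nat) : \det g = 1 ->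
  (2 < t)%N -> \tr g = t%:Z -> hyp_norm R g = dilation R t ^+ 2.
Proof.
move=> dg t2 tg; congr (_ ^+ 2).
have [el l1 lt _] := dilation_facts R t2; move: el l1 lt.
move: (dilation R t) => lam el l1 lt.
have inE a : [set a : R | eigenvalue (map_mx intr g : 'M[R]_2) a] a <->
    a ^+ 2 - t%:R * a + 1 = 0.
  by rewrite /= eigenvalue2E // tg.
have ub : ubound [set a : R | eigenvalue (map_mx intr g : 'M[R]_2) a] lam.
  move=> a /inE ea; suff : ~ (lam < a) by move=> /negP; rewrite -leNgt.
  move=> la; have : (a - lam) * (a + lam - t%:R) = 0 by lra.
  move/eqP; rewrite mulf_eq0 subr_eq0 => /orP[/eqP aE|/eqP h].
    by move: la; rewrite aE ltxx.
  have aE : a = t%:R - lam by rewrite -[LHS]subr0 -[in LHS]h; ring.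
  have : lam * a = 1 by rewrite aE; lra.
  have : 1 < lam * a by rewrite -[1]mulr1; apply: ltr_pM => //; apply: lt_trans la.
  by lra.
rewrite /larger_eigenvalue; apply/eqP; rewrite eq_le; apply/andP; split.
  by apply: ge_sup => //; exists lam; apply/inE.
by apply: ub_le_sup; [exists lam|apply/inE].
Qed.

(** Because t <= lam^2 and lam >= 2, both log t and 1 are at most 2 log lam. *)
Lemma harmonic_sum_le_ln_dilation (R : realType) (t : nat) : (2 < t)%N ->
  harmonic_sum R t <= 4 * ln (dilation R t).
Proof.
move=> t2; have [el l1 lt lg] := dilation_facts R t2; move: el l1 lt lg.
set lam := dilation R t => el l1 lt lg.
have t3 : 3 <= t%:R :> R by rewrite (ler_nat _ 3).
apply: le_trans (@harmonic_sum_le_ln R t _) _; first by lia.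
have h1 : 1 - lam^-1 <= ln lam by apply: ln_ge_1BV; lra.
have h2 : lam^-1 <= 2^-1 by rewrite lef_pV2 ?posrE; lra.
have h3 : ln t%:R <= 2 * ln lam.
  have -> : 2 * ln lam = ln (lam ^+ 2) by rewrite lnXn ?mulr_natl //; lra.
  by rewrite ler_ln ?posrE; nra.
lra.
Qed.

(** The logarithm in the bound for the total weight cancels against log lam. *)
Lemma count_classes_trace_le (R : realType) (N : nat) (G : set 'M[int]_2) (t : nat)
  (Ks : seq (set 'M[int]_2)) :
  cong_group N G -> (2 < t)%N -> uniq Ks ->
  (forall K, K \in Ks -> exists g, [/\ G g, \tr g = t%:Z, primitive_in G g &
     K = conj_class G g]) ->
  (size Ks)%:R <= 32 * #|{: 'M['Z_N]_2}|%:R * t%:R * sq_divisor_sum R t t.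
Proof.
move=> cG t2 uK hK; have [el l1 _ _] := dilation_facts R t2.
have := count_classes_trace_weighted cG t2 el l1 uK hK.
have hl := harmonic_sum_le_ln_dilation R t2.
have lp : 0 < ln (dilation R t) by rewrite ln_gt0.
have hU := @root_ratio_sum_le R t (ltnW t2).
move: lp hl hU; set L := ln _; set m := #|_|%:R; set S := sq_divisor_sum _ _ _ => lp hl hU h.
have S0 : 0 <= S by apply: sq_divisor_sum_ge0.
rewrite -(ler_pM2r lp); apply: le_trans h _.
have m0 : 0 <= m by rewrite /m.
apply: le_trans (_ : 4 * m * (2 * t%:R * ((4 * L) * S)) <= _); last first.
  by rewrite le_eqVlt; apply/orP; left; apply/eqP; ring.
apply: ler_wpM2l; first by rewrite mulr_ge0.
apply: le_trans hU _; apply: ler_wpM2l; first by rewrite mulr_ge0.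
exact: ler_wpM2r.
Qed.

(** The elementary inequalities in x and y.  From log x >= 7 / 10 the constants
    that occur are absorbed in multiples of (log x)^2 < y / sqrt x. *)
Lemma window_numbers (R : realType) (x y : R) : 17 / 5 <= x -> y < x ->
  Num.sqrt x * ln x ^+ 2 < y ->
  let s := Num.sqrt x in
  [/\ 9 / 5 <= s, s ^+ 2 = x, Num.sqrt (x + y) <= 3 / 2 * s,
      s * (Num.sqrt (x + y) - s + 2) <= 5 * y &
      s * (1 + ln (3 * s)) ^+ 2 <= 25 * y].
Proof.
move=> x3 yx hy s.
have x0 : 0 <= x by lra.
have s0 : 0 <= s by apply: sqrtr_ge0.
have s2 : s ^+ 2 = x by apply: sqr_sqrtr.
have s18 : 9 / 5 <= s.
  by rewrite leNgt; apply/negP => h; nra.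
have y0 : 0 < y.
  by apply: le_lt_trans hy; rewrite mulr_ge0 ?sqr_ge0.
have xy0 : 0 <= x + y by lra.
have q2 := sqr_sqrtr xy0; have q0 := sqrtr_ge0 (x + y).
move: q2 q0; set q := Num.sqrt (x + y) => q2 q0.
have qs : q <= 3 / 2 * s.
  rewrite leNgt; apply/negP => h.
  have : (3 / 2 * s) ^+ 2 < q ^+ 2 by rewrite ltr_sqr ?nnegrE; lra.
  rewrite q2 exprMn s2; lra.
have sq : s <= q by rewrite ler_sqrt; lra.
have L1 : 7 / 10 <= ln x.
  have h1 : 1 - x^-1 <= ln x by apply: ln_ge_1BV; lra.
  have h2 : x^-1 <= (17 / 5)^-1 by rewrite lef_pV2 ?posrE; lra.
  lra.
have sL : s * ln x ^+ 2 <= y by apply: ltW.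
have sL' : s * (49 / 100) <= s * ln x ^+ 2.
  by apply: ler_wpM2l => //; nra.
split=> //.
  have : 2 * (s * (q - s)) <= y by nra.
  lra.
have lns : ln (3 * s) <= 2 + ln x / 2.
  rewrite lnM ?posrE; [|lra|lra].
  have l3 : ln 3 <= 2 :> R by have := @le_ln1Dx R 2 ltac:(lra); rewrite (_ : 1 + 2 = 3) //; ring.
  have ls : ln s = ln x / 2.
    have sp : 0 < s by lra.
    have := @lnXn R 2 s sp; rewrite s2 mulr2n; lra.
  by rewrite ls lerD2r.
have lns0 : 0 <= ln (3 * s) by rewrite ln_ge0; lra.
apply: le_trans (_ : s * (25 * ln x ^+ 2) <= _); last by lra.
apply: ler_wpM2l => //.
have -> : 25 * ln x ^+ 2 = (5 * ln x) ^+ 2 by rewrite exprMn; congr (_ * _); ring.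
rewrite ler_sqr ?nnegrE; lra.
Qed.

Lemma size_le_sum_fibers (T : eqType) (s : seq T) (p : nat -> pred T) (T0 h : nat) :
  (forall x, x \in s -> exists2 t, (T0 <= t < T0 + h)%N & p t x) ->
  (size s <= \sum_(k < h) size [seq x <- s | p (T0 + k)%N x])%N.
Proof.
move=> hs; under eq_bigr do rewrite size_filter -sum1_count big_mkcond /=.
rewrite exchange_big /= -sum1_size big_seq [leqRHS]big_seq.
apply: leq_sum => x /hs[t /andP[t1 t2] ptx].
have kh : (t - T0 < h)%N by rewrite ltn_subLR.
by rewrite (bigD1 (Ordinal kh)) //= subnKC // ptx.
Qed.

(** Here t = lam + 1 / lam lies between lam and lam + 1. *)
Lemma trace_window (R : realType) (x q : R) (t : nat) : (2 < t)%N ->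
  0 <= x -> 0 <= q -> x <= dilation R t ^+ 2 -> dilation R t ^+ 2 < q ^+ 2 ->
  Num.sqrt x < t%:R /\ t%:R <= q + 1.
Proof.
move=> t2 x0 q0; have [_ l1 lt lg] := dilation_facts R t2; move: l1 lt lg.
move: (dilation R t) => lam l1 lt lg h1 h2; split.
  apply: le_lt_trans lt; rewrite -(@ler_sqr R) ?nnegrE ?sqrtr_ge0 ?sqr_sqrtr //; lra.
have : lam < q by rewrite -(@ltr_sqr R) ?nnegrE //; lra.
lra.
Qed.

(** The value at t = 3 is (7 + 3 sqrt 5) / 2 > 34 / 5.  If x + y < 2 x exceeds it,
    then x > 17 / 5 and log x is bounded away from 0. *)
Lemma dilation_sq_gt (R : realType) (t : nat) : (2 < t)%N ->
  34 / 5 < dilation R t ^+ 2.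
Proof.
move=> t2; have [el l1 lt lg] := dilation_facts R t2; move: el l1 lt lg.
move: (dilation R t) => lam el l1 lt lg.
have t3 : 3 <= t%:R :> R by rewrite (ler_nat _ 3).
suff : 261 / 100 <= lam by nra.
by rewrite leNgt; apply/negP => h; nra.
Qed.

(** The integers of the interval (s, q + 1], where s and q stand for sqrt x and
    sqrt (x + y), truncated below at 3. *)
Lemma trace_range (R : realType) (s q : R) : 9 / 5 <= s -> s <= q -> q <= 3 / 2 * s ->
  exists T0 h M : nat,
   [/\ (2 < T0)%N, (T0 + h <= M.+1)%N, h%:R <= q - s + 2, M%:R <= 3 * s &
     forall t : nat, (2 < t)%N -> s < t%:R -> t%:R <= q + 1 -> (T0 <= t < T0 + h)%N].
Proof.
move=> s18 sq q32.
have s0 : 0 <= s by lra.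
have q10 : 0 <= q + 1 by lra.
have /andP[A1 A2] := truncn_itv s0; have /andP[B1 B2] := truncn_itv q10.
have AB : (Num.trunc s <= Num.trunc (q + 1))%N by apply: le_truncn; lra.
have big t : t%:R <= q + 1 -> (t <= Num.trunc (q + 1))%N by rewrite truncn_ge_nat.
have small t : s < t%:R -> (Num.trunc s < t)%N.
  by move=> st; rewrite -(ltr_nat R); apply: le_lt_trans st.
move: (Num.trunc s) (Num.trunc (q + 1)) A1 A2 B1 B2 AB big small => A B A1 A2 B1 B2 AB big small.
have A3 : A.+1%:R <= 3 * s by rewrite -natr1; lra.
have B3 : B%:R <= 3 * s by lra.
have T3s : 3%:R <= 3 * s by lra.
have hBA : (B - A)%:R <= q - s + 2.
  by rewrite natrB //; move: A2; rewrite -natr1; lra.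
clear s18 q32 s0 q10 A1 A2 B1 B2 sq.
exists (maxn 3 A.+1), (B.+1 - maxn 3 A.+1)%N, (maxn (maxn 3 A.+1) B); split.
- by rewrite leq_maxl.
- by clear -AB; lia.
- by apply: le_trans hBA; rewrite ler_nat; clear -AB; lia.
- by have [_|_] := leqP B (maxn 3 A.+1); [have [_|_] := leqP A.+1 3|].
- move=> t t2 /small At /big tB; clear -t2 At tB; lia.
Qed.

(** The classes are sorted by trace.  The constant 81 * 80 = 96 (6 * 5 + 3 / 2 * 25)
    collects those of [count_classes_trace_le], [sum_sq_divisor_sum_le] and
    [window_numbers]. *)
Lemma window_count (R : realType) (N : nat) (G : set 'M[int]_2) (x y : R)
  (Ks : seq (set 'M[int]_2)) :
  cong_group N G -> 1 < x -> Num.sqrt x * ln x ^+ 2 < y -> y < x -> uniq Ks ->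
  (forall K, K \in Ks -> exists g, [/\ G g, hyperbolic g, primitive_in G g,
     K = conj_class G g & x <= hyp_norm R g < x + y]) ->
  (size Ks)%:R <= (81 * 80) * #|{: 'M['Z_N]_2}|%:R * y.
Proof.
move=> cG x1 hy yx uK hK; case: (cG) => Gdet _ _ _.
have y0 : 0 < y.
  by apply: le_lt_trans hy; rewrite mulr_ge0 ?sqr_ge0 ?sqrtr_ge0.
have hKt K : K \in Ks -> exists t : nat, [/\ (2 < t)%N,
    x <= dilation R t ^+ 2 < x + y &
    exists g, [/\ G g, \tr g = t%:Z, primitive_in G g & K = conj_class G g]].
  move=> /hK[g [Gg tg pg KE hn]]; exists (absz (\tr g)).
  move: tg; rewrite /hyperbolic => tg.
  have tE : \tr g = (absz (\tr g))%:Z by rewrite gtz0_abs //; lia.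
  have t2 : (2 < absz (\tr g))%N by lia.
  split=> //; last by exists g.
  by rewrite -(hyp_normE R (Gdet _ Gg) t2 tE).
have [m mE m0] : exists2 m : R, m = #|{: 'M['Z_N]_2}|%:R & 0 <= m by eexists.
rewrite -mE.
have [->|[K0 KsK0]] : Ks = [::] \/ exists K, K \in Ks.
  by case: (Ks) => [|K Ks']; [left|right; exists K; rewrite mem_head].
  by rewrite !mulr_ge0 // ltW.
have x3 : 17 / 5 <= x.
  have [t [t2 /andP[_ h] _]] := hKt _ KsK0.
  have := dilation_sq_gt R t2; lra.
have [s18 s2 q32 hA hB] := window_numbers x3 yx hy.
have xy0 : 0 <= x + y by lra.
have q2 := sqr_sqrtr xy0; have q0 := sqrtr_ge0 (x + y).
have s0 := sqrtr_ge0 x; have x0 : 0 <= x by lra.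
move: s18 s2 q32 hA hB q2 q0 s0.
set s := Num.sqrt x; set q := Num.sqrt (x + y) => s18 s2 q32 hA hB q2 q0 s0.
have sq : s <= q by rewrite ler_sqrt; lra.
have [T0 [h [M [T3 hM hR MR hT]]]] := trace_range s18 sq q32.
have harmM : harmonic_sum R M <= 1 + ln (3 * s).
  have [->|M0] := posnP M.
    by rewrite /harmonic_sum big_ord_recr big_ord0 /= invr0 addr0 addr_ge0 // ln_ge0; lra.
  apply: le_trans (harmonic_sum_le_ln R M0) _; rewrite lerD2l ler_ln ?posrE ?ltr0n //; lra.
pose p t K := `[< exists g, [/\ G g, \tr g = t%:Z, primitive_in G g & K = conj_class G g] >].
have fib : (size Ks <= \sum_(k < h) size [seq K <- Ks | p (T0 + k)%N K])%N.
  apply: size_le_sum_fibers => K /hKt[t [t2 /andP[n1 n2] ex]].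
  exists t; last exact/asboolP.
  rewrite -q2 in n2.
  have [w1 w2] := trace_window t2 x0 q0 n1 n2.
  exact: hT.
apply: le_trans (_ : (\sum_(k < h) size [seq K <- Ks | p (T0 + k)%N K])%:R <= _).
  by rewrite ler_nat.
rewrite natr_sum.
apply: le_trans (_ : \sum_(k < h) 96 * m * s * sq_divisor_sum R (T0 + k) (T0 + k) <= _).
  apply: ler_sum => k _.
  have t2 : (2 < T0 + k)%N by apply: leq_trans T3 (leq_addr _ _).
  have tM : (T0 + k <= M)%N.
    by rewrite -ltnS; apply: leq_trans hM; rewrite ltn_add2l.
  have tR : (T0 + k)%:R <= 3 * s by apply: le_trans MR; rewrite ler_nat.
  have := @count_classes_trace_le R N G (T0 + k) [seq K <- Ks | p (T0 + k)%N K] cG t2.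
  move=> /(_ (filter_uniq _ uK)); rewrite -mE.
  have S0 : 0 <= sq_divisor_sum R (T0 + k) (T0 + k) by apply: sq_divisor_sum_ge0.
  move=> H; apply: le_trans (H _) _.
    by move=> K; rewrite mem_filter => /andP[/asboolP].
  rewrite ler_wpM2r // (_ : 96 * m * s = 32 * m * (3 * s)); last by ring.
  by rewrite ler_wpM2l // mulr_ge0.
rewrite -mulr_sumr.
have SS := sum_sq_divisor_sum_le R T3 hM.
apply: le_trans (_ : 96 * m * s * (6 * h%:R + 3 / 2 * harmonic_sum R M ^+ 2) <= _).
  by rewrite ler_wpM2l // !mulr_ge0.
have h1 : s * h%:R <= 5 * y.
  by apply: le_trans hA; rewrite ler_wpM2l.
have h2 : s * harmonic_sum R M ^+ 2 <= 25 * y.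
  apply: le_trans hB; rewrite ler_wpM2l // ler_sqr ?nnegrE ?harmonic_sum_ge0 //.
  by apply: le_trans harmM; apply: harmonic_sum_ge0.
rewrite (_ : 96 * m * s * _ = m * ((24 * 24) * (s * h%:R) + (12 * 12) * (s * harmonic_sum R M ^+ 2)));
  last by field.
rewrite (_ : 81 * 80 * m * y = m * (81 * 80 * y)); last by ring.
rewrite ler_wpM2l //; lra.
Qed.

Theorem corollary1p2 (R : realType) (N : nat) (hN : (1 < N)%N)
    (G : set 'M[int]_2)
    (hG : G = Gamma0 N \/ G = Gamma1 N \/ G = GammaN N) :
  exists C : R, 0 < C /\
    forall x y : R, 1 < x -> Num.sqrt x * (ln x) ^+ 2 < y -> y < x ->
      (primeg_count G (x + y))%:R - (primeg_count G x)%:R <= C * y.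
Proof.
have cG := cong_group_Gamma hN hG.
exists ((81 * 80) * #|{: 'M['Z_N]_2}|%:R); split.
  by rewrite mulr_gt0 // ltr0n; apply/card_gt0P; exists 0.
move=> x y x1 hy yx.
have y0 : 0 < y.
  by apply: le_lt_trans hy; rewrite mulr_ge0 ?sqr_ge0 ?sqrtr_ge0.
have C0 : 0 <= (81 * 80) * #|{: 'M['Z_N]_2}|%:R * y by rewrite !mulr_ge0 // ltW.
rewrite /primeg_count.
have [fin|inf] := pselect (finite_set (prim_hyp_classes G (x + y))); last first.
  (* an infinite set of classes is counted as empty *)
  rewrite [fset_set (prim_hyp_classes G (x + y))]/fset_set; case: pselect => // _.
  by apply: le_trans C0; rewrite cardfs0 sub0r oppr_le0.
have sub : prim_hyp_classes G x `<=` prim_hyp_classes G (x + y).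
  move=> K [g [Gg hg pg ng] <-]; exists g => //; split=> //.
  by apply: lt_trans ng _; rewrite ltrDl.
have finx : finite_set (prim_hyp_classes G x) by apply: sub_finite_set fin.
set E := fset_set (prim_hyp_classes G (x + y)).
set E' := fset_set (prim_hyp_classes G x).
have cardD : (#|` E| <= #|` E'| + #|` (E `\` E')%fset|)%N.
  by rewrite -(cardfsID E' E) leq_add2r fsubset_leq_card // fsubsetIr.
rewrite lerBlDl; apply: le_trans (_ : (#|` E'| + #|` (E `\` E')%fset|)%:R <= _).
  by rewrite ler_nat.
rewrite natrD lerD2l.
apply: (window_count cG x1 hy yx); first exact: fset_uniq.
move=> K; rewrite in_fsetD => /andP[]; rewrite /E /E' !in_fset_set // => nK.
rewrite inE => -[g [Gg hg pg ng] KE]; exists g; split=> //.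
rewrite ng andbT leNgt; apply/negP => ngx; case/negP: nK.
by rewrite inE; exists g.
Qed.
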